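(* The following four integral evaluations hold: $$\int_0^1 \frac{\mathbf{E}\left(\sqrt{1-x}\right)\, \mathbf{K}^2\left(\sqrt{\frac12 - \frac{1}{\sqrt2}\sqrt{\frac{1-\sqrt{1-x}}{x}}}\right)}{\sqrt[4]{2\sqrt{1-x} - x + 2}}\, dx = \pi^2\left(\frac{17}{30} - \frac{\ln(1+\sqrt2)}{2\sqrt2}\right),$$ $$\int_0^1 \frac{\mathbf{E}\left(\sqrt{1-x}\right)\, \mathbf{K}^2\left(\frac{1}{2\sqrt2}\sqrt{4 - \sqrt6\sqrt{\frac{\sqrt{16x+9}-3}{x}}}\right)}{\sqrt[4]{8x + 3\sqrt{16x+9} + 9}}\, dx = \frac{1}{\sqrt[4]{2}}\left(\frac{47\pi^2}{160} - \frac{\pi^3}{16\sqrt3}\right),$$ $$\int_0^1 \frac{\mathbf{E}\left(\sqrt{1-x}\right)\, \mathbf{K}^2\left(\sqrt{\frac12 - \frac14\sqrt{\frac{\sqrt{8x+1}-1}{x}}}\right)}{\sqrt[4]{4x + \sqrt{8x+1} + 1}}\, dx = \frac{1}{2^{7/4}}\left(\frac{71\pi^2}{60} - \frac{\pi^3}{8}\right),$$ $$\int_0^1 \frac{\mathbf{E}\left(\sqrt{1-x}\right)\, \mathbf{K}^2\left(\sqrt{\frac12 - \frac{1}{4\sqrt6}\sqrt{\frac{\sqrt{48x+1}-1}{x}}}\right)}{\sqrt[4]{24x + \sqrt{48x+1} + 1}}\, dx = \frac{\pi^2\left(143 - \frac{20\pi}{\sqrt3}\right)}{480\sqrt[4]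{2}}.$$
   Context: The complete elliptic integrals of the first and second kind, as functions of the modulus $k$, are $\mathbf{K}(k) = \int_0^{\pi/2} (1 - k^2\sin^2\theta)^{-1/2}\, d\theta$ and $\mathbf{E}(k) = \int_0^{\pi/2} \sqrt{1-k^2\sin^2\theta}\, d\theta$; they depend only on $k^2$, so they are also defined (by the same integrals) when $k$ is purely imaginary. $\mathbf{K}^2(\cdot)$ denotes the square of $\mathbf{K}(\cdot)$. *)

(* Defs.v *)
From Stdlib Require Import Reals Lra.
From Coquelicot Require Import Coquelicot.
Open Scope R_scope.

(* Principal square root: real part >= 0, cut along the negative real axis,
   with value i * sqrt |z| there, so that [Csqrt] of a negative real is purely
   imaginary. *)
Definition Csqrt (z : C) : C :=
  (sqrt ((Cmod z + Re z) / 2),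
   if Rlt_dec (Im z) 0 then - sqrt ((Cmod z - Re z) / 2)
   else sqrt ((Cmod z - Re z) / 2)).

Lemma Csqrt_sqr (z : C) : (Csqrt z * Csqrt z)%C = z.
Proof.
destruct z as [a b].
pose proof (Rle_trans _ _ _ (Rmax_l _ _) (Rmax_Cmod (a, b))) as Ha.
assert (Hm : Cmod (a, b) * Cmod (a, b) = a * a + b * b).
{ unfold Cmod; simpl; rewrite sqrt_sqrt; nra. }
simpl in Ha; unfold Csqrt; simpl.
set (m := Cmod (a, b)) in *.
assert (Hpm : - m <= a <= m) by (unfold Rabs in Ha; destruct (Rcase_abs a); lra).
assert (Hp : 0 <= (m + a) / 2) by lra.
assert (Hq : 0 <= (m - a) / 2) by lra.
assert (Hpq : sqrt ((m + a) / 2) * sqrt ((m - a) / 2) = Rabs b / 2).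
{ rewrite <- sqrt_mult by assumption.
  replace ((m + a) / 2 * ((m - a) / 2)) with (Rsqr (b / 2)) by (unfold Rsqr; nra).
  rewrite sqrt_Rsqr_abs; unfold Rdiv; rewrite Rabs_mult, (Rabs_right (/ 2)); lra. }
pose proof (sqrt_sqrt _ Hp) as Sp; pose proof (sqrt_sqrt _ Hq) as Sq.
unfold Cmult; simpl; destruct (Rlt_dec b 0) as [Hb | Hb].
- rewrite Rabs_left in Hpq by lra; f_equal; nra.
- rewrite Rabs_right in Hpq by lra; f_equal; nra.
Qed.

Lemma Csqrt_RtoC (x : R) : 0 <= x -> Csqrt (RtoC x) = RtoC (sqrt x).
Proof.
intros Hx; unfold Csqrt; rewrite Cmod_R, Rabs_right by lra; unfold RtoC; simpl.
destruct (Rlt_dec 0 0) as [H | _]; [lra |].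
f_equal; [f_equal; lra | rewrite <- sqrt_0; f_equal; lra].
Qed.

(* [k] is the modulus, not the parameter k^2. When k is real with |k| < 1 or
   purely imaginary, 1 - k^2 sin^2 t is a positive real and [Csqrt] is the real
   square root. *)
Definition ellipK (k : C) : C :=
  RInt (V := C_R_CompleteNormedModule)
    (fun t : R => / Csqrt (1 - k ^ 2 * RtoC (sin t) ^ 2))%C 0 (PI / 2).

Definition ellipE (k : C) : C :=
  RInt (V := C_R_CompleteNormedModule)
    (fun t : R => Csqrt (1 - k ^ 2 * RtoC (sin t) ^ 2))%C 0 (PI / 2).

(* [Rpower] is the real power only for a positive base. *)
Definition root4 (x : R) : R := Rpower x (1 / 4).

(* Main.v *)
Require Import Defs.
From Stdlib Require Import Reals Lra Lia.
From Coquelicot Require Import Coquelicot.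
Open Scope R_scope.

(** Let A_n = (1/2)_n / n!, and for c in {1, -16/9, -8, -48} put u = sqrt (1 - c x) and
    a = sqrt (2 / (1 + u)). Each of the four integrands is a constant times
    E(sqrt (1 - x)) Q(c x), where Q(c x) = a K^2 with k^2 = (1 - a) / 2 ([weighted_K2]),
    so one evaluation depending on c is enough.

    Near z = 0, Q(z) is (PI/2)^2 times the sum of A_(2n) A_n^2 z^n, and the integral of
    x^n E(sqrt (1 - x)) times A_n^2 is a rational function of n ([is_RInt_moment]). The
    factors A_n^2 thus disappear on integration, and what is left is an integral of the
    algebraic function h(z), the sum of A_(2n) z^n ([kernel]), against an elementary
    density ([arcsine_pair_moment]). Its integrals are elementary in
    T = y sqrt (2 / (1 + v)), where v = sqrt (1 - c y^2) ([is_RInt_kernel_weight],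
    [is_RInt_kernel_mean]).

    The power series diverge for |c| > 1, so polynomials replace them. Writing
    z = 4 p / (1 + p)^2 with |p| < 1, h(z s^2) is sqrt (1 + p) times the generating series
    of the even Legendre polynomials P_(2k)(s) in p ([gen_even_closed]). Its partial sums
    approximate h(z s^2) uniformly in s for every z < 1. The A_n^2 are the moments of a
    product of two arcsine variables; averaging P_(2k) over s^2 with that law gives
    (-1)^k A_k^3 ([saalschuetz]), and the resulting series of A_k^3 (-p)^k is (2 K / PI)^2
    by Clausen's formula ([ellK_clausen]). Averaging does not increase the uniform
    distance ([arcsine_pair_close]), so the moment identity for polynomials passes to the
    limit ([is_RInt_kernel_transform]). This settles c < 1; the case c = 1 follows by
    continuity in c ([is_RInt_weighted_K2_1]). *)

(** * Calculus on the real line *)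

(** Library lemmas may leave an equation over the carrier of a structure on [R], which
    [ring] and [field] do not recognise. *)
Ltac toR := match goal with |- @eq _ ?a ?b => change (@eq R a b) end.

Lemma eq_of_zero_derive (f : R -> R) (a b : R) :
  (forall x, Rmin a b < x < Rmax a b -> is_derive f x 0) ->
  (forall x, Rmin a b <= x <= Rmax a b -> continuous f x) -> f b = f a.
Proof.
intros Hd Hc.
destruct (MVT_gen f a b (fun _ => 0)) as [c [_ Hf]].
- exact Hd.
- intros x Hx; apply continuity_pt_filterlim, Hc, Hx.
- lra.
Qed.

Lemma continuous_sqrt_comp (f : R -> R) x : continuous f x -> continuous (fun x => sqrt (f x)) x.
Proof. intros Hf; apply (continuous_comp f sqrt); [exact Hf | apply continuous_sqrt]. Qed.

Lemma is_RInt_eq (f : R -> R) (a b l l' : R) : is_RInt f a b l -> l = l' -> is_RInt f a b l'.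
Proof. intros H <-; exact H. Qed.

Lemma is_RInt_lin (f g : R -> R) (c a b If Ig : R) :
  is_RInt f a b If -> is_RInt g a b Ig ->
  is_RInt (fun t => c * f t + g t) a b (c * If + Ig).
Proof.
intros Hf Hg.
apply (is_RInt_plus (V := R_NormedModule) (fun t => c * f t) g); [|exact Hg].
apply (is_RInt_scal (V := R_NormedModule) f), Hf.
Qed.

Lemma is_RInt_scalR (f : R -> R) (c a b If : R) :
  is_RInt f a b If -> is_RInt (fun t => c * f t) a b (c * If).
Proof. apply (is_RInt_scal (V := R_NormedModule) f a b c If). Qed.

Lemma is_RInt_constR (a b c : R) : is_RInt (fun _ => c) a b ((b - a) * c).
Proof. apply (is_RInt_const (V := R_NormedModule)). Qed.

Lemma ex_RInt_cont (f : R -> R) (a b : R) :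
  (forall x, Rmin a b <= x <= Rmax a b -> continuous f x) -> ex_RInt f a b.
Proof. apply (ex_RInt_continuous (V := R_CompleteNormedModule)). Qed.

Lemma is_RInt_RInt (f : R -> R) (a b : R) : ex_RInt f a b -> is_RInt f a b (RInt f a b).
Proof. apply (@RInt_correct R_CompleteNormedModule). Qed.

Lemma is_RInt_uniq (f : R -> R) (a b l l' : R) : is_RInt f a b l -> is_RInt f a b l' -> l = l'.
Proof.
intros H H'; apply (is_RInt_unique (V := R_CompleteNormedModule)) in H, H'.
rewrite <- H; exact H'.
Qed.

Lemma is_RInt_dist (f g : R -> R) (a b If Ig e : R) :
  a <= b -> is_RInt f a b If -> is_RInt g a b Ig ->
  (forall x, a <= x <= b -> Rabs (f x - g x) <= e) -> Rabs (If - Ig) <= (b - a) * e.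
Proof.
intros Hab Hf Hg H.
replace (If - Ig) with (-1 * Ig + If) by ring.
apply (norm_RInt_le_const (V := R_NormedModule) (fun t => -1 * g t + f t) a b); auto.
- intros x Hx; replace (-1 * g x + f x) with (f x - g x) by ring; apply H, Hx.
- apply is_RInt_lin; assumption.
Qed.

Lemma eq_of_close (x y c : R) : 0 <= c -> (forall e, 0 < e -> Rabs (x - y) <= c * e) -> x = y.
Proof.
intros Hc H; apply cond_eq; intros e He.
apply Rle_lt_trans with (c * (e / (c + 1))).
- apply H, Rdiv_lt_0_compat; lra.
- apply Rmult_lt_reg_r with (c + 1); [lra|]; unfold Rdiv; field_simplify; nra.
Qed.

Lemma pos_of_nonzero (f : R -> R) (p : R) :
  (forall y, Rmin 0 p <= y <= Rmax 0 p -> continuous f y) ->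
  (forall y, Rmin 0 p <= y <= Rmax 0 p -> f y <> 0) -> 0 < f 0 -> 0 < f p.
Proof.
intros Hc Hn H0.
assert (Hc' : forall y, Rmin 0 p <= y <= Rmax 0 p -> continuity_pt f y)
  by (intros y Hy; apply continuity_pt_filterlim, Hc, Hy).
destruct (Rtotal_order (f p) 0) as [H | [H | H]]; [exfalso | exfalso | exact H].
- destruct (Rtotal_order 0 p) as [Hp | [<- | Hp]]; [| lra |].
  + rewrite Rmin_left, Rmax_right in * by lra.
    destruct (Ranalysis5.IVT_interv (fun x => - f x) 0 p) as [z [Hz Hfz]]; try lra.
    * intros a Ha; apply continuity_pt_opp, Hc', Ha.
    * apply (Hn z Hz); lra.
  + rewrite Rmin_right, Rmax_left in * by lra.
    destruct (Ranalysis5.IVT_interv f p 0) as [z [Hz Hfz]]; try lra; auto.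
    apply (Hn z Hz Hfz).
- apply (Hn p); [|exact H]; unfold Rmin, Rmax; destruct (Rle_dec 0 p); lra.
Qed.

Lemma is_RInt_sum (f : nat -> R -> R) (a b : R) (I : nat -> R) (N : nat) :
  (forall k, is_RInt (f k) a b (I k)) ->
  is_RInt (fun t => sum_f_R0 (fun k => f k t) N) a b (sum_f_R0 I N).
Proof.
intros H; induction N as [|N IH]; simpl; [apply H|].
apply (is_RInt_plus (V := R_NormedModule) (fun t => sum_f_R0 (fun k => f k t) N) (f (S N))); auto.
Qed.

(** [f] minus the indefinite integral of [df] has zero derivative inside and is
    continuous up to the ends. This serves antiderivatives that are not differentiable at an
    end, such as those built from x K(sqrt (1 - x)) at 0. *)
Lemma is_RInt_derive_interior (f df : R -> R) (a b : R) :
  a <= b ->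
  (forall x, a < x < b -> is_derive f x (df x)) ->
  (forall x, a <= x <= b -> continuous f x) ->
  (forall x, continuous df x) ->
  is_RInt df a b (f b - f a).
Proof.
intros Hab Hd Hf Hdf.
assert (Hex : forall x y, ex_RInt df x y)
  by (intros x y; apply (ex_RInt_continuous (V := R_CompleteNormedModule)); auto).
assert (HG : forall x, is_derive (RInt df a) x (df x)).
{ intros x; apply (is_derive_RInt df (RInt df a) a x); [|apply Hdf].
  apply filter_forall; intros y; apply (@RInt_correct R_CompleteNormedModule), Hex. }
assert (E : f b - RInt df a b = f a - RInt df a a).
{ apply (eq_of_zero_derive (fun x => f x - RInt df a x) a b);
    rewrite Rmin_left, Rmax_right by lra; intros x Hx.
  - replace 0 with (minus (df x) (df x)) by (unfold minus, plus, opp; simpl; ring).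
    apply (is_derive_minus f (RInt df a)); [apply Hd, Hx | apply HG].
  - apply (continuous_minus f (RInt df a)); [apply Hf, Hx |].
    apply (ex_derive_continuous (RInt df a)); eexists; apply HG. }
rewrite (RInt_point (V := R_CompleteNormedModule)) in E; unfold zero in E; simpl in E.
replace (f b - f a) with (RInt df a b) by lra.
apply (@RInt_correct R_CompleteNormedModule), Hex.
Qed.

Lemma sum_S_first (f : nat -> R) (N : nat) :
  sum_f_R0 f (S N) = f O + sum_f_R0 (fun j => f (S j)) N.
Proof. rewrite decomp_sum by lia; reflexivity. Qed.

Lemma sum_lin (f g : nat -> R) (a b : R) (N : nat) :
  sum_f_R0 (fun j => a * f j + b * g j) N = a * sum_f_R0 f N + b * sum_f_R0 g N.
Proof. induction N as [|N IH]; simpl; [reflexivity | rewrite IH; ring]. Qed.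

Lemma sum_zero_ext (f : nat -> R) (N M : nat) : (N <= M)%nat ->
  (forall j, (N < j)%nat -> f j = 0) -> sum_f_R0 f M = sum_f_R0 f N.
Proof.
intros HNM Hf; induction HNM as [|M HNM IH]; [reflexivity|].
simpl; rewrite IH, Hf by lia; ring.
Qed.

Lemma sin2_range (t : R) : 0 <= sin t ^ 2 <= 1.
Proof. assert (H := sin2_cos2 t); unfold Rsqr in H; split; nra. Qed.

Lemma PI2_pos : 0 < PI / 2. Proof. assert (H := PI_RGT_0); lra. Qed.

Lemma Rabs_mult_le1 (x y : R) : Rabs x <= 1 -> Rabs y <= 1 -> Rabs (x * y) <= 1.
Proof.
intros Hx Hy; rewrite Rabs_mult, <- (Rmult_1_l 1).
apply Rmult_le_compat; auto; apply Rabs_pos.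
Qed.

Lemma Rabs_mult_unit (m s : R) : 0 <= s <= 1 -> Rabs (m * s) <= Rabs m.
Proof.
intros Hs; rewrite Rabs_mult, (Rabs_right s) by lra.
assert (H := Rabs_pos m); nra.
Qed.

Lemma Rabs_sqrt_minus (x y : R) : Rabs (sqrt x - sqrt y) <= sqrt (Rabs (x - y)).
Proof.
assert (W : forall x y, x <= y -> sqrt y <= sqrt x + sqrt (y - x)).
{ clear; intros x y Hxy.
  destruct (Rle_dec 0 x) as [Hx | Hx].
  - assert (Ha := sqrt_pos x); assert (Hb := sqrt_pos (y - x)).
    apply Rsqr_incr_0_var; [|lra]; unfold Rsqr.
    rewrite sqrt_sqrt by lra.
    assert (E1 := sqrt_sqrt x Hx); assert (E2 := sqrt_sqrt (y - x) ltac:(lra)); nra.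
  - rewrite (sqrt_neg_0 x) by lra; rewrite Rplus_0_l; apply sqrt_le_1_alt; lra. }
destruct (Rle_dec x y) as [Hxy | Hxy].
- assert (H := W x y Hxy); assert (H' := sqrt_le_1_alt x y Hxy).
  rewrite (Rabs_left1 (sqrt x - sqrt y)), (Rabs_left1 (x - y)) by lra.
  replace (- (x - y)) with (y - x) by ring; lra.
- assert (H := W y x ltac:(lra)); assert (H' := sqrt_le_1_alt y x ltac:(lra)).
  rewrite !Rabs_right by lra; lra.
Qed.

(** * Power series with bounded coefficients *)

Lemma lt_CV_radius_of_bounded (a : nat -> R) (x : R) :
  (forall n, Rabs (a n) <= 1) -> Rabs x < 1 -> Rbar_lt (Rabs x) (CV_radius a).
Proof.
intros Ha Hx; apply Rbar_lt_le_trans with 1; [exact Hx |].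
apply (CV_radius_bounded a); exists 1; intros n; rewrite pow1, Rmult_1_r; apply Ha.
Qed.

(** The bound sees the coefficients only through their common bound 1, hence is uniform
    in any parameter on which they depend. *)
Lemma PSeries_tail (a : nat -> R) (x r : R) (N : nat) :
  (forall n, Rabs (a n) <= 1) -> Rabs x <= r < 1 ->
  Rabs (PSeries a x - sum_f_R0 (fun k => a k * x ^ k) N) <= r ^ S N / (1 - r).
Proof.
intros Ha [Hxr Hr].
assert (Hr0 : 0 <= r) by (pose proof (Rabs_pos x); lra).
assert (Hle : forall n, Rabs (a n * x ^ n) <= r ^ n).
{ intros n; rewrite Rabs_mult, <- RPow_abs, <- (Rmult_1_l (r ^ n)).
  apply Rmult_le_compat; try apply Rabs_pos; [|apply Ha|].
  - apply pow_le, Rabs_pos.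
  - apply pow_incr; split; [apply Rabs_pos | exact Hxr]. }
assert (Hg : ex_series (fun n => r ^ n)) by (apply ex_series_geom; rewrite Rabs_right; lra).
assert (Hex : ex_series (fun n => a n * x ^ n)).
{ apply (ex_series_le (V := R_CompleteNormedModule)) with (fun n => r ^ n); [exact Hle | exact Hg]. }
unfold PSeries; rewrite (Series_incr_n _ (S N)) by (lia || exact Hex).
simpl Nat.pred.
match goal with |- Rabs (?s + ?t - ?s) <= _ => replace (s + t - s) with t by ring end.
assert (Hgs : ex_series (fun k => r ^ S N * r ^ k))
  by exact (ex_series_scal (V := R_NormedModule) (r ^ S N) _ Hg).
assert (Hle' : forall k, Rabs (a (S N + k)%nat * x ^ (S N + k)) <= r ^ S N * r ^ k)
  by (intros k; rewrite <- pow_add; apply Hle).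
assert (Habs : ex_series (fun k => Rabs (a (S N + k)%nat * x ^ (S N + k)))).
{ apply (ex_series_le (V := R_CompleteNormedModule)) with (fun k => r ^ S N * r ^ k);
    [|exact Hgs].
  intros k; unfold norm; simpl; unfold abs; simpl; rewrite Rabs_Rabsolu; apply Hle'. }
eapply Rle_trans; [apply Series_Rabs, Habs |].
eapply Rle_trans.
- apply Series_le with (b := fun k => r ^ S N * r ^ k); [|exact Hgs].
  intros k; split; [apply Rabs_pos | apply Hle'].
- rewrite Series_scal_l, Series_geom; [right; field; lra | rewrite Rabs_right; lra].
Qed.

Lemma geom_small (r eps : R) :
  0 <= r < 1 -> 0 < eps -> exists N0, forall N, (N0 <= N)%nat -> r ^ S N / (1 - r) < eps.
Proof.
intros Hr He.
destruct (pow_lt_1_zero r) with (y := eps * (1 - r)) as [N0 HN].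
- rewrite Rabs_right; lra.
- nra.
- exists N0; intros N HN0; specialize (HN (S N) ltac:(lia)).
  rewrite Rabs_right in HN by (apply Rle_ge, pow_le; lra).
  apply Rmult_lt_reg_r with (1 - r); [lra|].
  unfold Rdiv; rewrite Rmult_assoc, Rinv_l by lra; lra.
Qed.

Lemma is_pseries_lin (a b : nat -> R) (c x la lb : R) :
  is_pseries a x la -> is_pseries b x lb ->
  is_pseries (fun n => c * a n + b n) x (c * la + lb).
Proof.
intros Ha Hb.
apply (is_pseries_plus (fun n => c * a n) b); [|exact Hb].
apply (is_pseries_scal c a x la); [apply Rmult_comm | exact Ha].
Qed.

Lemma is_pseries_shift (a : nat -> R) (x l : R) :
  is_pseries a x l ->
  is_pseries (fun n => match n with O => 0 | S k => a k end) x (x * l).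
Proof. intros Ha; apply (is_pseries_incr_1 a x l Ha). Qed.

Lemma is_derive_bounded_PSeries (a : nat -> R) (x : R) :
  (forall n, Rabs (a n) <= 1) -> Rabs x < 1 ->
  is_derive (PSeries a) x (PSeries (PS_derive a) x).
Proof. intros Ha Hx; apply is_derive_PSeries, lt_CV_radius_of_bounded; assumption. Qed.

Lemma is_pseries_bounded (a : nat -> R) (x : R) :
  (forall n, Rabs (a n) <= 1) -> Rabs x < 1 -> is_pseries a x (PSeries a x).
Proof. intros Ha Hx; apply PSeries_correct, CV_radius_inside, lt_CV_radius_of_bounded; assumption. Qed.

Lemma is_pseries_PS_derive (a : nat -> R) (x : R) :
  (forall n, Rabs (a n) <= 1) -> Rabs x < 1 ->
  is_pseries (PS_derive a) x (PSeries (PS_derive a) x).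
Proof.
intros Ha Hx; apply PSeries_correct, CV_radius_inside.
rewrite CV_radius_derive; apply lt_CV_radius_of_bounded; assumption.
Qed.

Lemma continuous_PSeries (a : nat -> R) (x : R) :
  (forall n, Rabs (a n) <= 1) -> Rabs x < 1 -> continuous (PSeries a) x.
Proof.
intros Ha Hx; apply (ex_derive_continuous (PSeries a)); eexists.
apply is_derive_bounded_PSeries; assumption.
Qed.

Lemma is_pseries_theta (a : nat -> R) (x : R) :
  (forall n, Rabs (a n) <= 1) -> Rabs x < 1 ->
  is_pseries (fun n => INR n * a n) x (x * PSeries (PS_derive a) x).
Proof.
intros Ha Hx; eapply is_pseries_ext; [|apply is_pseries_shift, (is_pseries_PS_derive a x Ha Hx)].
intros [|n]; toR; [simpl; ring | reflexivity].
Qed.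

Lemma is_pseries_theta2 (a : nat -> R) (x : R) :
  (forall n, Rabs (a n) <= 1) -> Rabs x < 1 ->
  is_pseries (fun n => INR n ^ 2 * a n) x
    (x * (PSeries (PS_derive a) x + x * PSeries (PS_derive (PS_derive a)) x)).
Proof.
intros Ha Hx.
assert (H2 : is_pseries (PS_derive (PS_derive a)) x (PSeries (PS_derive (PS_derive a)) x)).
{ apply PSeries_correct, CV_radius_inside; rewrite !CV_radius_derive.
  apply lt_CV_radius_of_bounded; assumption. }
assert (H1 := is_pseries_theta a x Ha Hx).
assert (H := is_pseries_lin _ _ 1 _ _ _ (is_pseries_shift _ _ _ (is_pseries_shift _ _ _ H2)) H1).
replace (x * (PSeries (PS_derive a) x + x * PSeries (PS_derive (PS_derive a)) x)) with
  (1 * (x * (x * PSeries (PS_derive (PS_derive a)) x)) + x * PSeries (PS_derive a) x) by ring.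
eapply is_pseries_ext; [|exact H].
intros [|[|n]]; toR; unfold PS_derive; [simpl; ring .. |].
rewrite !S_INR; ring.
Qed.

Lemma between_0_lt1 p : Rabs p < 1 -> forall y, Rmin 0 p <= y <= Rmax 0 p -> Rabs y < 1.
Proof.
intros Hp y Hy; apply Rabs_def2 in Hp; apply Rabs_def1;
  revert Hy; unfold Rmin, Rmax; destruct (Rle_dec 0 p); lra.
Qed.

(** * The binomial series and Wallis integrals *)

(** (1/2)_n / n!, that is C(2n, n) / 4^n. *)
Fixpoint cbin (n : nat) : R :=
  match n with
  | O => 1
  | S k => cbin k * ((2 * INR k + 1) / (2 * INR k + 2))
  end.

Lemma cbin_bound (n : nat) : 0 < cbin n <= 1.
Proof.
induction n as [|n IH]; [simpl; lra|].
assert (Hn := pos_INR n).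
assert (H : 0 < (2 * INR n + 1) / (2 * INR n + 2) <= 1).
{ split; [apply Rdiv_lt_0_compat; lra|].
  apply Rmult_le_reg_r with (2 * INR n + 2); [lra|].
  unfold Rdiv; rewrite Rmult_assoc, Rinv_l; lra. }
simpl cbin; split; [apply Rmult_lt_0_compat; lra | nra].
Qed.

Lemma cbin_S (n : nat) : (2 * INR n + 2) * cbin (S n) = (2 * INR n + 1) * cbin n.
Proof. assert (Hn := pos_INR n); simpl; field; lra. Qed.

Lemma Rabs_cbin_pow (j n : nat) : Rabs (cbin n ^ j) <= 1.
Proof.
assert (H := cbin_bound n).
rewrite Rabs_right by (apply Rle_ge, pow_le; lra).
rewrite <- (pow1 j); apply pow_incr; lra.
Qed.

Lemma Rabs_cbin (n : nat) : Rabs (cbin n) <= 1.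
Proof. rewrite <- (pow_1 (cbin n)); apply Rabs_cbin_pow. Qed.

(** The equation is the recurrence of the coefficients read on the generating series. *)
Lemma cbin_PSeries_ode (x : R) : Rabs x < 1 ->
  2 * (1 - x) * PSeries (PS_derive cbin) x = PSeries cbin x.
Proof.
intros Hx.
assert (H0 := is_pseries_bounded _ _ Rabs_cbin Hx).
assert (H1 := is_pseries_PS_derive _ _ Rabs_cbin Hx).
assert (H2 := is_pseries_shift _ _ _ H1).
assert (H3 := is_pseries_lin _ _ (-1) _ _ _ H2 H1).
assert (H4 := is_pseries_lin _ _ 2 _ _ _ H3 (is_pseries_lin _ _ (-1) _ _ _ H0 H0)).
enough (E : 2 * (-1 * (x * PSeries (PS_derive cbin) x) + PSeries (PS_derive cbin) x) + 0 = PSeries cbin x) by lra.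
symmetry; apply is_pseries_unique.
eapply is_pseries_ext; [|replace 0 with (-1 * PSeries cbin x + PSeries cbin x) by ring; exact H4].
intros n; unfold PS_derive; destruct n as [|n].
- simpl; field.
- pose proof (cbin_S (S n)) as E; rewrite (S_INR (S n)); lra.
Qed.

(** By the differential equation the product of the series with sqrt (1 - x) is
    constant. *)
Lemma cbin_PSeries (x : R) : Rabs x < 1 -> PSeries cbin x = / sqrt (1 - x).
Proof.
intros Hx.
assert (Hin := between_0_lt1 x Hx).
assert (D : forall y, Rmin 0 x <= y <= Rmax 0 x ->
  is_derive (fun y => PSeries cbin y * sqrt (1 - y)) y 0).
{ intros y Hy; apply Hin in Hy; assert (Hy' := Rabs_def2 _ _ Hy).
  assert (Hs : 0 < sqrt (1 - y)) by (apply sqrt_lt_R0; lra).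
  assert (Hs2 : sqrt (1 - y) * sqrt (1 - y) = 1 - y) by (apply sqrt_sqrt; lra).
  assert (O := cbin_PSeries_ode y Hy).
  evar (d : R); replace 0 with d; [apply (is_derive_mult (PSeries cbin) (fun y => sqrt (1 - y)))|].
  - apply is_derive_bounded_PSeries; [exact Rabs_cbin | assumption].
  - auto_derive; [lra | reflexivity].
  - intros; apply Rmult_comm.
  - subst d; unfold plus, mult; simpl.
    change (1 + - y) with (1 - y).
    rewrite <- O; field_simplify; [|lra].
    replace (sqrt (1 - y) ^ 2) with (1 - y) by (simpl; rewrite Rmult_1_r; auto).
    field; lra. }
assert (E : PSeries cbin x * sqrt (1 - x) = PSeries cbin 0 * sqrt (1 - 0)).
{ apply (eq_of_zero_derive (fun y => PSeries cbin y * sqrt (1 - y))); intros y Hy.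
  - apply D; lra.
  - apply (ex_derive_continuous (fun y => PSeries cbin y * sqrt (1 - y))); eexists; apply D, Hy. }
rewrite PSeries_0, Rminus_0_r, sqrt_1 in E; simpl in E.
apply Rabs_def2 in Hx.
assert (Hs : 0 < sqrt (1 - x)) by (apply sqrt_lt_R0; lra).
apply Rmult_eq_reg_r with (sqrt (1 - x)); [|lra].
rewrite Rinv_l; lra.
Qed.

(** Coefficients of sqrt (1 - x), read off from (1 - x) / sqrt (1 - x). *)
Definition sqrt_coef (n : nat) : R :=
  match n with O => 1 | S k => cbin (S k) - cbin k end.

Lemma Rabs_sqrt_coef (n : nat) : Rabs (sqrt_coef n) <= 1.
Proof.
destruct n as [|n]; unfold sqrt_coef; [rewrite Rabs_R1; lra|].
assert (H := cbin_bound n); assert (H' := cbin_bound (S n)).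
apply Rabs_le; lra.
Qed.

Lemma sqrt_coef_PSeries (x : R) : Rabs x < 1 -> PSeries sqrt_coef x = sqrt (1 - x).
Proof.
intros Hx.
assert (H0 := is_pseries_bounded _ _ Rabs_cbin Hx).
assert (H1 := is_pseries_lin _ _ (-1) _ _ _ (is_pseries_shift _ _ _ H0) H0).
replace (sqrt (1 - x)) with (-1 * (x * PSeries cbin x) + PSeries cbin x).
- apply is_pseries_unique; eapply is_pseries_ext; [|exact H1].
  intros [|n]; toR; unfold sqrt_coef; [simpl|]; ring.
- rewrite cbin_PSeries by exact Hx; apply Rabs_def2 in Hx.
  assert (Hs : 0 < sqrt (1 - x)) by (apply sqrt_lt_R0; lra).
  apply Rmult_eq_reg_r with (sqrt (1 - x)); [|lra].
  rewrite sqrt_sqrt by lra; field; lra.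
Qed.

(** Integrating the derivative of sin^(2n+1) cos, whose boundary values vanish, gives
    the recurrence. *)
Lemma is_RInt_wallis (n : nat) :
  is_RInt (fun t => (sin t ^ 2) ^ n) 0 (PI / 2) (PI / 2 * cbin n).
Proof.
induction n as [|n IH].
- simpl; eapply is_RInt_eq; [apply is_RInt_constR | ring].
- assert (Hn := pos_INR n).
  assert (H : is_RInt (fun t => (2 * INR n + 1) * (sin t ^ 2) ^ n
                         - (2 * INR n + 2) * (sin t ^ 2) ^ S n) 0 (PI / 2) 0).
  { eapply is_RInt_eq; [apply (is_RInt_derive (fun t => sin t * (sin t ^ 2) ^ n * cos t))|].
    - intros t _; auto_derive; [exact I|].
      pose proof (sin2_cos2 t) as T; unfold Rsqr in T.
      destruct n as [|n].
      + simpl; ring_simplify; nra.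
      + rewrite S_INR; simpl Init.Nat.pred.
        simpl pow; simpl Init.Nat.pred.
        set (s := sin t) in *; set (c := cos t) in *.
        set (q := (s * (s * 1)) ^ n); fold q.
        assert (T' : c * c = 1 - s * s) by lra.
        transitivity (c * c * (2 * INR n + 3) * (s * s * q) - (s * s) * (s * s) * q); [ring|].
        rewrite T'; ring.
    - intros t _; apply (ex_derive_continuous (V := R_NormedModule)); auto_derive; exact I.
    - rewrite cos_PI2, sin_0; unfold minus, plus, opp; simpl; ring. }
  eapply is_RInt_eq; [|apply (Rmult_eq_reg_l (2 * INR n + 2)); [|lra]; symmetry].
  2: { rewrite Rmult_comm, Rmult_assoc, (Rmult_comm _ (2 * INR n + 2)), cbin_S. 
       replace (PI / 2 * ((2 * INR n + 1) * cbin n)) with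
         ((2 * INR n + 2) * (- / (2 * INR n + 2) * 0 + ((2 * INR n + 1) / (2 * INR n + 2) * (PI / 2 * cbin n) + 0))) by (field; lra).
       reflexivity. }
  eapply is_RInt_ext; [|apply is_RInt_lin; [exact H | apply is_RInt_lin; [exact IH|]];
     eapply is_RInt_eq; [apply (is_RInt_constR _ _ 0) | ring]].
  intros t _; toR; simpl; field; lra.
Qed.

(** Since |m sin^2 t| <= |m| < 1, the partial sums converge uniformly in t and can be
    integrated term by term. *)
Lemma is_RInt_wallis_PSeries (phi : nat -> R) (m : R) :
  (forall n, Rabs (phi n) <= 1) -> Rabs m < 1 ->
  is_RInt (fun t => PSeries phi (m * sin t ^ 2)) 0 (PI / 2)
    (PI / 2 * PSeries (fun n => phi n * cbin n) m).
Proof.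
intros Hphi Hm; assert (Hpi := PI2_pos).
assert (Hr : forall t, Rabs (m * sin t ^ 2) <= Rabs m)
  by (intros t; apply Rabs_mult_unit, sin2_range).
assert (H : is_RInt (fun t => PSeries phi (m * sin t ^ 2)) 0 (PI / 2)
              (RInt (fun t => PSeries phi (m * sin t ^ 2)) 0 (PI / 2))).
{ apply is_RInt_RInt, ex_RInt_cont; intros t _.
  apply (continuous_comp (fun t => m * sin t ^ 2) (PSeries phi)).
  - apply (ex_derive_continuous (V := R_NormedModule)); auto_derive; exact I.
  - apply continuous_PSeries; [exact Hphi | apply Rle_lt_trans with (Rabs m); auto]. }
eapply is_RInt_eq; [exact H|].
apply (eq_of_close _ _ (PI / 2 + PI / 2)); [lra|]; intros e He.
assert (Hm0 := Rabs_pos m).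
destruct (geom_small (Rabs m) e) as [N0 HN]; [lra | exact He |].
specialize (HN N0 (le_n _)).
set (J := PI / 2 * sum_f_R0 (fun k => phi k * cbin k * m ^ k) N0).
assert (HJ : is_RInt (fun t => sum_f_R0 (fun k => phi k * (m * sin t ^ 2) ^ k) N0) 0 (PI / 2) J).
{ unfold J; rewrite scal_sum.
  eapply is_RInt_eq; [apply (is_RInt_sum (fun k t => phi k * (m * sin t ^ 2) ^ k))|].
  - intros k; apply is_RInt_ext with (fun t => (phi k * m ^ k) * (sin t ^ 2) ^ k).
    + intros t _; toR; rewrite Rpow_mult_distr; ring.
    + apply (is_RInt_scal (V := R_NormedModule)), is_RInt_wallis.
  - apply sum_eq; intros k _; unfold scal; simpl; unfold mult; simpl; ring. }
replace (RInt (fun t => PSeries phi (m * sin t ^ 2)) 0 (PI / 2)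
   - PI / 2 * PSeries (fun n => phi n * cbin n) m) with
   ((RInt (fun t => PSeries phi (m * sin t ^ 2)) 0 (PI / 2) - J)
    - PI / 2 * (PSeries (fun n => phi n * cbin n) m
      - sum_f_R0 (fun k => phi k * cbin k * m ^ k) N0)) by (unfold J; ring).
eapply Rle_trans; [apply Rabs_triang|]; rewrite Rabs_Ropp, Rmult_plus_distr_r.
apply Rplus_le_compat.
- replace (PI / 2) with (PI / 2 - 0) at 2 by ring.
  refine (is_RInt_dist _ _ _ _ _ _ _ _ H HJ _); [lra|].
  intros t _; apply Rle_trans with (Rabs m ^ S N0 / (1 - Rabs m)); [|lra].
  apply PSeries_tail; [exact Hphi | split; auto].
- rewrite Rabs_mult, (Rabs_right (PI / 2)) by lra.
  apply Rmult_le_compat_l; [lra|].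
  apply Rle_trans with (Rabs m ^ S N0 / (1 - Rabs m)); [|lra].
  apply PSeries_tail; [|lra].
  intros n; apply Rabs_mult_le1; [apply Hphi | apply Rabs_cbin].
Qed.

(** * Elliptic integrals as functions of the parameter *)

(** The variable is the parameter m = k^2; a negative m stands for a purely imaginary
    modulus. *)
Definition ellK (m : R) : R := RInt (fun t => / sqrt (1 - m * sin t ^ 2)) 0 (PI / 2).

Definition ellE (m : R) : R := RInt (fun t => sqrt (1 - m * sin t ^ 2)) 0 (PI / 2).

Lemma ellK_arg_pos (m t : R) : m < 1 -> 0 < 1 - m * sin t ^ 2.
Proof. intros Hm; assert (H := sin2_range t); destruct (Rle_dec m 0); nra. Qed.

Lemma is_RInt_ellK (m : R) : m < 1 ->
  is_RInt (fun t => / sqrt (1 - m * sin t ^ 2)) 0 (PI / 2) (ellK m).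
Proof.
intros Hm; apply is_RInt_RInt, ex_RInt_cont; intros t _.
assert (H := ellK_arg_pos m t Hm).
apply (ex_derive_continuous (V := R_NormedModule)); auto_derive.
repeat split; [exact H | apply Rgt_not_eq, sqrt_lt_R0, H].
Qed.

Lemma is_RInt_ellE (m : R) :
  is_RInt (fun t => sqrt (1 - m * sin t ^ 2)) 0 (PI / 2) (ellE m).
Proof.
apply is_RInt_RInt, ex_RInt_cont; intros t _.
apply (continuous_comp (fun t => 1 - m * sin t ^ 2) sqrt); [|apply continuous_sqrt].
apply (ex_derive_continuous (V := R_NormedModule)); auto_derive; exact I.
Qed.

Definition ellK_coef (n : nat) : R := cbin n ^ 2.

Definition ellE_coef (n : nat) : R := sqrt_coef n * cbin n.

Lemma Rabs_ellK_coef n : Rabs (ellK_coef n) <= 1. Proof. apply Rabs_cbin_pow. Qed.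

Lemma Rabs_ellE_coef n : Rabs (ellE_coef n) <= 1.
Proof.
apply Rabs_mult_le1; [apply Rabs_sqrt_coef | apply Rabs_cbin].
Qed.

Lemma ellK_PSeries (m : R) : Rabs m < 1 -> ellK m = PI / 2 * PSeries ellK_coef m.
Proof.
intros Hm; apply (is_RInt_uniq (fun t => / sqrt (1 - m * sin t ^ 2)) 0 (PI / 2)).
- apply is_RInt_ellK; apply Rabs_def2 in Hm; lra.
- eapply is_RInt_ext; [|eapply is_RInt_eq; [apply (is_RInt_wallis_PSeries cbin m)|]].
  + intros t _; toR; apply cbin_PSeries.
    apply Rle_lt_trans with (Rabs m); [apply Rabs_mult_unit, sin2_range | exact Hm].
  + exact Rabs_cbin.
  + exact Hm.
  + f_equal; apply PSeries_ext; intros n; unfold ellK_coef; ring.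
Qed.

Lemma ellE_PSeries (m : R) : Rabs m < 1 -> ellE m = PI / 2 * PSeries ellE_coef m.
Proof.
intros Hm; apply (is_RInt_uniq (fun t => sqrt (1 - m * sin t ^ 2)) 0 (PI / 2)).
- apply is_RInt_ellE.
- eapply is_RInt_ext; [|apply (is_RInt_wallis_PSeries sqrt_coef m Rabs_sqrt_coef Hm)].
  intros t _; toR; apply sqrt_coef_PSeries.
  apply Rle_lt_trans with (Rabs m); [apply Rabs_mult_unit, sin2_range | exact Hm].
Qed.

Lemma ellK_pos (m : R) : m < 1 -> 0 < ellK m.
Proof.
intros Hm; assert (Hpi := PI2_pos).
assert (H : (PI / 2 - 0) * / sqrt (1 + Rabs m) <= ellK m).
{ refine (is_RInt_le _ _ 0 (PI / 2) _ _ _ (is_RInt_constR _ _ _) (is_RInt_ellK m Hm) _); [lra|].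
  intros t _; assert (H := ellK_arg_pos m t Hm); assert (Hs := sin2_range t).
  apply Rinv_le_contravar; [apply sqrt_lt_R0, H|]; apply sqrt_le_1_alt.
  assert (Ha := Rabs_mult_unit (- m) _ Hs); rewrite Rabs_Ropp in Ha.
  assert (Hb := Rle_abs (- m * sin t ^ 2)); lra. }
apply Rlt_le_trans with (2 := H); apply Rmult_lt_0_compat; [lra|].
apply Rinv_0_lt_compat, sqrt_lt_R0; assert (Ha := Rabs_pos m); lra.
Qed.

Lemma ellK_le (m : R) : m < 1 -> 0 <= m -> ellK m <= PI / 2 / sqrt (1 - m).
Proof.
intros Hm Hm0; assert (Hpi := PI2_pos).
replace (PI / 2 / sqrt (1 - m)) with ((PI / 2 - 0) * / sqrt (1 - m)) by (unfold Rdiv; ring).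
refine (is_RInt_le _ _ 0 (PI / 2) _ _ _ (is_RInt_ellK m Hm) (is_RInt_constR _ _ _) _); [lra|].
intros t _; assert (Hs := sin2_range t).
apply Rinv_le_contravar; [apply sqrt_lt_R0; lra |]; apply sqrt_le_1_alt; nra.
Qed.

(** The total square root is Hoelder of exponent 1/2 on the whole line, so E is too,
    across m = 1. *)
Lemma ellE_holder (m m' : R) : Rabs (ellE m - ellE m') <= PI / 2 * sqrt (Rabs (m - m')).
Proof.
assert (Hpi := PI2_pos).
replace (PI / 2) with (PI / 2 - 0) by ring.
refine (is_RInt_dist _ _ 0 (PI / 2) _ _ _ _ (is_RInt_ellE m) (is_RInt_ellE m') _); [lra|].
intros t _; eapply Rle_trans; [apply Rabs_sqrt_minus|]; apply sqrt_le_1_alt.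
replace (1 - m * sin t ^ 2 - (1 - m' * sin t ^ 2)) with ((m' - m) * sin t ^ 2) by ring.
rewrite (Rabs_minus_sym m m'); apply Rabs_mult_unit, sin2_range.
Qed.

Lemma continuous_ellE (m : R) : continuous ellE m.
Proof.
apply continuity_pt_filterlim; intros eps He.
assert (Hpi := PI2_pos).
exists ((eps / PI) ^ 2); split.
- apply pow_lt, Rdiv_lt_0_compat; lra.
- intros x [_ Hx]; unfold Rdist in *; simpl in *; unfold Rdist in *.
  eapply Rle_lt_trans; [apply ellE_holder|].
  apply Rle_lt_trans with (PI / 2 * (eps / PI)).
  + apply Rmult_le_compat_l; [lra|].
    rewrite <- (sqrt_pow2 (eps / PI)) by (apply Rlt_le, Rdiv_lt_0_compat; lra).
    apply sqrt_le_1_alt; simpl; lra.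
  + field_simplify; lra.
Qed.

Lemma ellE_bounds (m : R) : 0 <= m -> 0 <= ellE m <= PI / 2.
Proof.
intros Hm; assert (Hpi := PI2_pos); split.
- refine (is_RInt_ge_0 _ 0 (PI / 2) _ _ (is_RInt_ellE m) _); [lra|]; intros; apply sqrt_pos.
- replace (PI / 2) with ((PI / 2 - 0) * 1) by ring.
  refine (is_RInt_le _ _ 0 (PI / 2) _ _ _ (is_RInt_ellE m) (is_RInt_constR _ _ _) _); [lra|].
  intros t _; apply Rle_trans with (sqrt 1); [|rewrite sqrt_1; lra].
  apply sqrt_le_1_alt; assert (H := sin2_range t); nra.
Qed.

Lemma ellE_1 : ellE 1 = 1.
Proof.
assert (Hpi := PI2_pos).
apply (is_RInt_uniq _ _ _ _ _ (is_RInt_ellE 1)).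
apply is_RInt_ext with cos.
- intros t Ht; rewrite Rmin_left, Rmax_right in Ht by lra; toR.
  assert (H := sin2_cos2 t); unfold Rsqr in H.
  replace (1 - 1 * sin t ^ 2) with (cos t ^ 2) by nra.
  rewrite sqrt_pow2; [reflexivity | apply cos_ge_0; lra].
- eapply is_RInt_eq; [apply (is_RInt_derive sin cos)|].
  + intros t _; auto_derive; [exact I | ring].
  + intros t _; apply (ex_derive_continuous (V := R_NormedModule)); auto_derive; exact I.
  + rewrite sin_PI2, sin_0; unfold minus, plus, opp; simpl; ring.
Qed.

(** * Moments of the second elliptic integral *)

Lemma sqrt_coef_cbin (n : nat) : (2 * INR n - 1) * sqrt_coef n = - cbin n.
Proof.
destruct n as [|n]; [simpl; ring|].
unfold sqrt_coef; rewrite S_INR; pose proof (cbin_S n); lra.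
Qed.

(** Legendre's formula 2 m E' = E - K. *)
Lemma ellE_coef_ode (m : R) : Rabs m < 1 ->
  2 * m * PSeries (PS_derive ellE_coef) m = PSeries ellE_coef m - PSeries ellK_coef m.
Proof.
intros Hm.
assert (H := is_pseries_lin _ _ (-1) _ _ _ (is_pseries_bounded _ _ Rabs_ellK_coef Hm)
               (is_pseries_bounded _ _ Rabs_ellE_coef Hm)).
assert (H' := is_pseries_lin _ _ 2 _ _ _ (is_pseries_theta _ _ Rabs_ellE_coef Hm)
               (is_pseries_lin _ _ (-1) _ _ _ H H)).
apply is_pseries_unique in H; apply is_pseries_unique in H'.
rewrite (PSeries_ext _ (fun n => -1 * ellK_coef n + ellE_coef n)) in H'; [lra|].
intros n; unfold ellK_coef, ellE_coef.
assert (E := sqrt_coef_cbin n).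
replace (cbin n ^ 2) with (- ((2 * INR n - 1) * sqrt_coef n) * cbin n) by (rewrite E; ring).
ring.
Qed.

(** Legendre's formula 2 m (1 - m) K' = E - (1 - m) K. *)
Lemma ellK_coef_ode (m : R) : Rabs m < 1 ->
  2 * m * (1 - m) * PSeries (PS_derive ellK_coef) m = PSeries ellE_coef m - (1 - m) * PSeries ellK_coef m.
Proof.
intros Hm.
assert (H0 := is_pseries_bounded _ _ Rabs_ellK_coef Hm).
assert (HE := is_pseries_bounded _ _ Rabs_ellE_coef Hm).
assert (H1 := is_pseries_theta _ _ Rabs_ellK_coef Hm).
assert (HL := is_pseries_lin _ _ 2 _ _ _
   (is_pseries_lin _ _ (-1) _ _ _ (is_pseries_shift _ _ _ H1) H1)
   (is_pseries_lin _ _ (-1) _ _ _ (is_pseries_shift _ _ _ H0) H0)).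
apply is_pseries_unique in HL; apply is_pseries_unique in HE.
rewrite (PSeries_ext _ ellE_coef) in HL; [lra|].
intros [|n]; unfold ellK_coef, ellE_coef; [simpl; ring|].
unfold sqrt_coef; pose proof (cbin_S n) as E; rewrite S_INR.
set (a := cbin (S n)) in *; set (b := cbin n) in *; set (N := INR n) in *.
replace ((a - b) * a) with (a ^ 2 - a * b) by ring.
transitivity ((2 * N + 2) * a * a + a ^ 2 - (2 * N + 1) * b * b); [ring|].
replace ((2 * N + 1) * b) with ((2 * N + 2) * a) by lra.
replace ((2 * N + 2) * a * a) with ((2 * N + 1) * b * a) by (rewrite <- E; ring).
transitivity (a ^ 2 - a * b + ((2 * N + 2) * b * a - (2 * N + 2) * a * b)); ring.
Qed.

Lemma Rabs_1m (x : R) : 0 < x <= 1 -> Rabs (1 - x) < 1.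
Proof. intros Hx; rewrite Rabs_right; lra. Qed.

Lemma is_derive_ellE (m : R) : Rabs m < 1 ->
  is_derive ellE m (PI / 2 * PSeries (PS_derive ellE_coef) m).
Proof.
intros Hm.
apply is_derive_ext_loc with (fun m => PI / 2 * PSeries ellE_coef m).
- apply (filter_imp (fun y => Rabs y < 1)); [intros y Hy; symmetry; apply ellE_PSeries, Hy|].
  apply (open_comp Rabs (fun y => y < 1)); [intros; apply continuous_Rabs| apply open_lt | exact Hm].
- apply (is_derive_scal (PSeries ellE_coef)), is_derive_bounded_PSeries; [apply Rabs_ellE_coef | exact Hm].
Qed.

Lemma is_derive_ellK (m : R) : Rabs m < 1 ->
  is_derive ellK m (PI / 2 * PSeries (PS_derive ellK_coef) m).
Proof.
intros Hm.
apply is_derive_ext_loc with (fun m => PI / 2 * PSeries ellK_coef m).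
- apply (filter_imp (fun y => Rabs y < 1)); [intros y Hy; symmetry; apply ellK_PSeries, Hy|].
  apply (open_comp Rabs (fun y => y < 1)); [intros; apply continuous_Rabs| apply open_lt | exact Hm].
- apply (is_derive_scal (PSeries ellK_coef)), is_derive_bounded_PSeries; [apply Rabs_ellK_coef | exact Hm].
Qed.

Lemma is_derive_ellE_compl (x : R) : 0 < x < 1 ->
  is_derive (fun x => ellE (1 - x)) x ((ellK (1 - x) - ellE (1 - x)) / (2 * (1 - x))).
Proof.
intros Hx; assert (Hm := Rabs_1m x ltac:(lra)).
evar_last.
- apply (is_derive_comp ellE (fun x => 1 - x)); [apply is_derive_ellE, Hm | auto_derive; [exact I | reflexivity]].
- unfold scal; simpl; unfold mult; simpl.
  assert (E := ellE_coef_ode _ Hm); rewrite ellK_PSeries, ellE_PSeries by exact Hm.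
  replace (PSeries ellK_coef (1 - x)) with (PSeries ellE_coef (1 - x) - 2 * (1 - x) * PSeries (PS_derive ellE_coef) (1 - x)) by lra.
  field; lra.
Qed.

Lemma is_derive_ellK_compl (x : R) : 0 < x < 1 ->
  is_derive (fun x => ellK (1 - x)) x ((x * ellK (1 - x) - ellE (1 - x)) / (2 * x * (1 - x))).
Proof.
intros Hx; assert (Hm := Rabs_1m x ltac:(lra)).
evar_last.
- apply (is_derive_comp ellK (fun x => 1 - x)); [apply is_derive_ellK, Hm | auto_derive; [exact I | reflexivity]].
- unfold scal; simpl; unfold mult; simpl.
  assert (E := ellK_coef_ode _ Hm); rewrite ellK_PSeries, ellE_PSeries by exact Hm.
  replace (PSeries ellE_coef (1 - x)) with (2 * (1 - x) * x * PSeries (PS_derive ellK_coef) (1 - x) + x * PSeries ellK_coef (1 - x)) by lra.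
  field; lra.
Qed.

Lemma continuous_ellE_compl (x : R) : continuous (fun x => ellE (1 - x)) x.
Proof.
apply (continuous_comp (fun x => 1 - x) ellE); [|apply continuous_ellE].
apply (ex_derive_continuous (V := R_NormedModule)); auto_derive; exact I.
Qed.

(** The crude bound K <= (PI/2) / sqrt x at parameter 1 - x makes x K tend to 0 with x.
    The absolute value extends the function to both sides of 0. *)
Lemma continuous_xK (x : R) : 0 <= x <= 1 -> continuous (fun x => x * ellK (1 - Rabs x)) x.
Proof.
intros [[Hx | <-] Hx1].
- apply (continuous_mult (fun x => x) (fun x => ellK (1 - Rabs x))); [apply continuous_id|].
  apply (continuous_comp (fun x => 1 - Rabs x) ellK).
  + apply (continuous_minus (fun _ => 1) Rabs); [apply continuous_const | apply continuous_Rabs].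
  + apply (ex_derive_continuous ellK); eexists; apply is_derive_ellK.
    rewrite (Rabs_right x) by lra; apply Rabs_1m; lra.
- apply continuity_pt_filterlim; intros eps He.
  assert (Hpi := PI2_pos).
  (* x K <= (PI/2) sqrt x, hence a radius quadratic in eps *)
  exists (Rmin 1 ((eps / PI) ^ 2)); split.
  + apply Rmin_glb_lt; [lra | apply pow_lt, Rdiv_lt_0_compat; lra].
  + intros y [_ Hy]; simpl in *; unfold Rdist in *.
    rewrite Rmult_0_l, Rminus_0_r in *.
    assert (H1 := Rlt_le_trans _ _ _ Hy (Rmin_l _ _)).
    assert (H2 := Rlt_le_trans _ _ _ Hy (Rmin_r _ _)).
    destruct (Req_dec y 0) as [-> | Hy0]; [rewrite Rmult_0_l, Rabs_R0; exact He|].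
    assert (Hp := Rabs_pos_lt y Hy0).
    set (r := Rabs y) in *.
    rewrite Rabs_mult; fold r.
    rewrite (Rabs_right (ellK (1 - r))) by (apply Rle_ge, Rlt_le, ellK_pos; lra).
    assert (H3 := ellK_le (1 - r) ltac:(lra) ltac:(lra)).
    replace (1 - (1 - r)) with r in H3 by ring.
    assert (Hs : 0 < sqrt r) by (apply sqrt_lt_R0; exact Hp).
    assert (Hss : sqrt r * sqrt r = r) by (apply sqrt_sqrt; lra).
    assert (H4 : sqrt r <= eps / PI).
    { rewrite <- (sqrt_pow2 (eps / PI)) by (apply Rlt_le, Rdiv_lt_0_compat; lra).
      apply sqrt_le_1_alt; simpl; lra. }
    apply Rle_lt_trans with (r * (PI / 2 / sqrt r)); [apply Rmult_le_compat_l; lra|].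
    apply Rle_lt_trans with (PI / 2 * sqrt r).
    { right; rewrite <- Hss at 1; field; lra. }
    apply Rle_lt_trans with (PI / 2 * (eps / PI)); [apply Rmult_le_compat_l; lra|].
    field_simplify; lra.
Qed.

Lemma ellK_0 : ellK 0 = PI / 2.
Proof. rewrite ellK_PSeries, PSeries_0 by (rewrite Rabs_R0; lra); unfold ellK_coef; simpl; ring. Qed.

Lemma ellE_0 : ellE 0 = PI / 2.
Proof. rewrite ellE_PSeries, PSeries_0 by (rewrite Rabs_R0; lra); unfold ellE_coef; simpl; ring. Qed.

(** Multiplying the hypergeometric equation of x -> E(sqrt (1 - x)) by x^n and
    integrating by parts twice gives the antiderivative x^(n+1) (K - E) / 2 - (n+1) x^n (1 -
    x) E, with K and E at modulus sqrt (1 - x). It vanishes at both ends, except at x = 0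
    when n = 0, where E = 1. *)
Lemma moment_recurrence (n : nat) :
  is_RInt (fun x => ((INR n + 1) ^ 2 - 1 / 4) * x ^ n * ellE (1 - x)
                    - INR n * (INR n + 1) * x ^ pred n * ellE (1 - x)) 0 1
    (match n with O => 1 | S _ => 0 end).
Proof.
set (F := fun x => x ^ n * ((x * ellK (1 - Rabs x) - x * ellE (1 - x)) / 2)
                   - (INR n + 1) * x ^ n * (1 - x) * ellE (1 - x)).
eapply is_RInt_eq; [apply (is_RInt_derive_interior F); [lra| | |]|].
- intros x Hx.
  apply is_derive_ext_loc with (fun x => x ^ n * ((x * ellK (1 - x) - x * ellE (1 - x)) / 2)
                   - (INR n + 1) * x ^ n * (1 - x) * ellE (1 - x)).
  { apply (filter_imp (fun y => 0 < y)); [|apply (open_gt 0); lra].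
    intros y Hy; unfold F; rewrite (Rabs_right y) by lra; reflexivity. }
  assert (DE := is_derive_ellE_compl x Hx); assert (DK := is_derive_ellK_compl x Hx).
  set (e := fun x => ellE (1 - x)) in *; set (k := fun x => ellK (1 - x)) in *.
  apply is_derive_ext with (fun x => x ^ n * ((x * k x - x * e x) / 2)
                   - (INR n + 1) * x ^ n * (1 - x) * e x); [reflexivity|].
  change (ellE (1 - x)) with (e x) in *; change (ellK (1 - x)) with (k x) in *.
  assert (XE : Derive (fun y => e y) x = (k x - e x) / (2 * (1 - x)))
    by exact (is_derive_unique _ _ _ DE).
  assert (XK : Derive (fun y => k y) x = (x * k x - e x) / (2 * x * (1 - x)))
    by exact (is_derive_unique _ _ _ DK).
  auto_derive.
  + repeat split; auto; eexists; eassumption.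
  + rewrite XE, XK.
    destruct n as [|n]; [simpl; field; lra|].
    simpl Init.Nat.pred; rewrite S_INR; simpl; field; lra.
- intros x Hx; unfold F.
  assert (P : forall c : R, continuous (fun x => c * x ^ n) x)
    by (intros c; apply (ex_derive_continuous (V := R_NormedModule)); auto_derive; exact I).
  apply (continuous_minus (fun x => x ^ n * ((x * ellK (1 - Rabs x) - x * ellE (1 - x)) / 2))
           (fun x => (INR n + 1) * x ^ n * (1 - x) * ellE (1 - x))).
  + apply (continuous_mult (fun x => x ^ n)).
    * apply (ex_derive_continuous (V := R_NormedModule)); auto_derive; exact I.
    * apply (continuous_mult (fun x => x * ellK (1 - Rabs x) - x * ellE (1 - x)) (fun _ => / 2));
        [|apply continuous_const].
      apply (continuous_minus (fun x => x * ellK (1 - Rabs x)) (fun x => x * ellE (1 - x)));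
        [apply continuous_xK, Hx|].
      apply (continuous_mult (fun x => x) (fun x => ellE (1 - x)));
        [apply continuous_id | apply continuous_ellE_compl].
  + apply (continuous_mult (fun x => (INR n + 1) * x ^ n * (1 - x)) (fun x => ellE (1 - x)));
      [|apply continuous_ellE_compl].
    apply (ex_derive_continuous (V := R_NormedModule)); auto_derive; exact I.
- intros x.
  apply continuous_ext with (fun x => (((INR n + 1) ^ 2 - 1 / 4) * x ^ n
                    - INR n * (INR n + 1) * x ^ pred n) * ellE (1 - x)); [intros; toR; ring|].
  apply (continuous_mult (fun x => ((INR n + 1) ^ 2 - 1 / 4) * x ^ n
                    - INR n * (INR n + 1) * x ^ pred n) (fun x => ellE (1 - x)));
      [|apply continuous_ellE_compl].
  apply (ex_derive_continuous (V := R_NormedModule)); auto_derive; exact I.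
- unfold F; rewrite Rabs_R1, Rabs_R0, Rminus_0_r, !Rminus_diag, ellK_0, ellE_0.
  rewrite ellE_1; destruct n as [|n]; [simpl; field|].
  rewrite pow_i, pow1 by lia; field.
Qed.

(** The moments of E(sqrt (1 - x)) are quotients of Gamma values; the factor [cbin n ^
    2] cancels them and leaves a rational function of n. *)
Lemma is_RInt_moment (n : nat) :
  is_RInt (fun x => cbin n ^ 2 * x ^ n * ellE (1 - x)) 0 1
    ((INR n + 1) / (2 * (INR n + 1 / 2) ^ 2 * (INR n + 3 / 2))).
Proof.
induction n as [|n IH].
- assert (H := moment_recurrence 0).
  assert (H0 := is_RInt_lin _ _ (4 / 3) _ _ _ _ H (is_RInt_constR 0 1 0)).
  eapply is_RInt_ext; [|eapply is_RInt_eq; [exact H0|]].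
  + intros x _; toR; simpl; field.
  + simpl; field.
- assert (Hn := pos_INR n); assert (Hb := cbin_bound n).
  assert (H := moment_recurrence (S n)); simpl Init.Nat.pred in H.
  rewrite S_INR in H; rewrite S_INR.
  set (c := / ((INR n + 1 + 1) ^ 2 - 1 / 4)).
  assert (Hc : ((INR n + 1 + 1) ^ 2 - 1 / 4) <> 0) by nra.
  assert (HL := is_RInt_lin _ _ (c * (INR n + 1) * (INR n + 1 + 1) * ((INR n + 1/2) / (INR n + 1)) ^ 2)
     _ _ _ _ IH (is_RInt_lin _ _ (c * cbin (S n) ^ 2) _ _ _ _ H (is_RInt_constR 0 1 0))).
  assert (E : cbin (S n) = cbin n * ((INR n + 1 / 2) / (INR n + 1)))
    by (simpl; field; lra).
  eapply is_RInt_ext; [|eapply is_RInt_eq; [exact HL|]].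
  + intros x _; toR; cbv beta; rewrite E; unfold c; field; lra.
  + unfold c; field; repeat split; nra.
Qed.

(** * Clausen's formula *)

Definition cube_coef (n : nat) : R := cbin n ^ 3.

(** With S the sum of a_n^3 z^n and theta = z d/dz, the combination (1 - z) theta^2 S -
    (z/2) theta S - (z/8) S has these coefficients. The third order equation theta^3 S = z
    (theta + 1/2)^3 S says exactly that its derivative is theta S / 8. *)
Definition cube_aux_coef (n : nat) : R :=
  match n with O => 0 | S k => INR k * cbin k ^ 3 / (8 * (INR k + 1)) end.

Lemma Rabs_cube_coef n : Rabs (cube_coef n) <= 1. Proof. apply Rabs_cbin_pow. Qed.

Lemma Rabs_cube_aux_coef n : Rabs (cube_aux_coef n) <= 1.
Proof.
destruct n as [|k]; simpl cube_aux_coef; [rewrite Rabs_R0; lra|].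
assert (Hk := pos_INR k).
replace (INR k * (cbin k * (cbin k * (cbin k * 1))) / (8 * (INR k + 1)))
  with (INR k / (8 * (INR k + 1)) * cbin k ^ 3) by (field; lra).
apply Rabs_mult_le1; [|apply Rabs_cbin_pow].
rewrite Rabs_right by (apply Rle_ge, Rdiv_le_0_compat; lra).
apply Rmult_le_reg_r with (8 * (INR k + 1)); [lra|].
unfold Rdiv; rewrite Rmult_assoc, Rinv_l by lra; lra.
Qed.

Definition cube_series (z : R) : R := PSeries cube_coef z.

Definition cube_theta (z : R) : R := z * PSeries (PS_derive cube_coef) z.

Definition cube_aux (z : R) : R := PSeries cube_aux_coef z.

Definition dcube_theta (z : R) : R :=
  PSeries (PS_derive cube_coef) z + z * PSeries (PS_derive (PS_derive cube_coef)) z.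

Lemma is_derive_cube_series z : Rabs z < 1 ->
  is_derive cube_series z (PSeries (PS_derive cube_coef) z).
Proof. intros Hz; apply is_derive_bounded_PSeries; [apply Rabs_cube_coef | exact Hz]. Qed.

Lemma is_derive_cube_theta z : Rabs z < 1 -> is_derive cube_theta z (dcube_theta z).
Proof.
intros Hz.
assert (D : is_derive (PSeries (PS_derive cube_coef)) z (PSeries (PS_derive (PS_derive cube_coef)) z)).
{ apply is_derive_PSeries; rewrite CV_radius_derive.
  apply lt_CV_radius_of_bounded; [apply Rabs_cube_coef | exact Hz]. }
evar_last; [eapply (is_derive_mult (fun z => z) (PSeries (PS_derive cube_coef)));
   [apply is_derive_id | exact D | intros; apply Rmult_comm]|].
unfold dcube_theta, plus, mult, one; simpl; ring.
Qed.

Lemma is_derive_cube_aux z : Rabs z < 1 -> is_derive cube_aux z (cube_theta z / 8).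
Proof.
intros Hz; evar_last; [apply is_derive_bounded_PSeries; [apply Rabs_cube_aux_coef | exact Hz]|].
assert (H := is_pseries_theta cube_coef z Rabs_cube_coef Hz).
apply is_pseries_unique.
assert (H' := is_pseries_lin _ _ (/ 8 - 1) _ _ _ H H).
replace (cube_theta z / 8) with ((/ 8 - 1) * (z * PSeries (PS_derive cube_coef) z) + z * PSeries (PS_derive cube_coef) z)
  by (unfold cube_theta; field).
eapply is_pseries_ext; [|exact H'].
intros n; toR; unfold PS_derive, cube_coef; simpl cube_aux_coef; rewrite S_INR.
assert (Hn := pos_INR n); field; lra.
Qed.

Lemma cube_series_ode z : Rabs z < 1 ->
  (1 - z) * (z * dcube_theta z) = cube_aux z + z / 2 * cube_theta z + z / 8 * cube_series z.
Proof.
intros Hz.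
assert (H0 := is_pseries_bounded _ _ Rabs_cube_coef Hz).
assert (H1 := is_pseries_theta _ _ Rabs_cube_coef Hz).
assert (H2 := is_pseries_theta2 _ _ Rabs_cube_coef Hz).
assert (HL := is_pseries_lin _ _ (-1) _ _ _ (is_pseries_shift _ _ _ H2)
   (is_pseries_lin _ _ (- / 2) _ _ _ (is_pseries_shift _ _ _ H1)
   (is_pseries_lin _ _ (- / 8) _ _ _ (is_pseries_shift _ _ _ H0) H2))).
apply is_pseries_unique in HL.
rewrite (PSeries_ext _ cube_aux_coef) in HL.
- unfold cube_aux, cube_theta, cube_series, dcube_theta; lra.
- intros [|n]; [unfold cube_aux_coef; simpl; ring|].
  assert (Hn := pos_INR n); unfold cube_coef; rewrite S_INR; simpl cube_aux_coef; simpl cbin.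
  field; lra.
Qed.

(** The difference of the two sides is a first integral of the third order equation, and
    it vanishes at 0. It expresses that the solution is the square of a solution of a second
    order equation. *)
Lemma cube_series_invariant z : Rabs z < 1 -> (1 - z) * cube_theta z ^ 2 =
  2 * cube_series z * cube_aux z.
Proof.
intros Hz.
assert (Hin := between_0_lt1 z Hz).
assert (D : forall y, Rabs y < 1 ->
  is_derive (fun y => (1 - y) * cube_theta y ^ 2 - 2 * cube_series y * cube_aux y) y
    (- cube_theta y ^ 2 + 2 * (1 - y) * cube_theta y * dcube_theta y
     - 2 * (PSeries (PS_derive cube_coef) y * cube_aux y + cube_series y * (cube_theta y / 8)))).
{ intros y Hy.
  assert (D0 := is_derive_cube_series y Hy); assert (D1 := is_derive_cube_theta y Hy); assert (D2 := is_derive_cube_aux y Hy).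
  assert (X0 : Derive (fun y => cube_series y) y = _) by exact (is_derive_unique _ _ _ D0).
  assert (X1 : Derive (fun y => cube_theta y) y = _) by exact (is_derive_unique _ _ _ D1).
  assert (X2 : Derive (fun y => cube_aux y) y = _) by exact (is_derive_unique _ _ _ D2).
  auto_derive; [repeat split; auto; eexists; eassumption|].
  rewrite X0, X1, X2; ring. }
enough (E : (1 - z) * cube_theta z ^ 2 - 2 * cube_series z * cube_aux z = (1 - 0) * cube_theta 0 ^ 2 - 2 * cube_series 0 * cube_aux 0).
{ assert (E0 : (1 - 0) * cube_theta 0 ^ 2 - 2 * cube_series 0 * cube_aux 0 = 0)
    by (unfold cube_theta, cube_aux; rewrite (PSeries_0 cube_aux_coef); simpl; ring).
  lra. }
apply (eq_of_zero_derive (fun y => (1 - y) * cube_theta y ^ 2 - 2 * cube_series y * cube_aux y)); intros y Hy.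
- evar_last; [apply D, Hin; lra|].
  assert (O := cube_series_ode y (Hin y ltac:(lra))).
  assert (Hy0 : y <> 0) by (revert Hy; unfold Rmin, Rmax; destruct (Rle_dec 0 z); lra).
  apply Rmult_eq_reg_l with y; [|exact Hy0].
  transitivity (- y * cube_theta y ^ 2 + 2 * cube_theta y * ((1 - y) * (y * dcube_theta y)) -
    2 * (cube_theta y * cube_aux y + y * cube_series y * (cube_theta y / 8))); [unfold cube_theta; ring|].
  rewrite O; field.
- apply (ex_derive_continuous (fun y => (1 - y) * cube_theta y ^ 2 - 2 * cube_series y * cube_aux y)).
  eexists; apply D, Hin, Hy.
Qed.

(** Coefficients of g = m (1 - m) y', where y is the series of K; Legendre's equation
    then reads g' = y / 4. *)
Definition flux_coef (n : nat) : R :=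
  match n with O => 0 | S k => cbin k ^ 2 / (4 * (INR k + 1)) end.

Lemma Rabs_flux_coef n : Rabs (flux_coef n) <= 1.
Proof.
destruct n as [|k]; simpl flux_coef; [rewrite Rabs_R0; lra|].
assert (Hk := pos_INR k).
replace (cbin k * (cbin k * 1) / (4 * (INR k + 1)))
  with (/ (4 * (INR k + 1)) * cbin k ^ 2) by (field; lra).
apply Rabs_mult_le1; [|apply Rabs_cbin_pow].
rewrite Rabs_right by (apply Rle_ge, Rlt_le, Rinv_0_lt_compat; lra).
rewrite <- Rinv_1; apply Rinv_le_contravar; lra.
Qed.

Definition ellK_series (m : R) : R := PSeries ellK_coef m.

Definition ellK_flux (m : R) : R := PSeries flux_coef m.

Lemma ellK_flux_eq m : Rabs m < 1 -> ellK_flux m = m * (1 - m) * PSeries (PS_derive ellK_coef) m.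
Proof.
intros Hm.
assert (H1 := is_pseries_theta _ _ Rabs_ellK_coef Hm).
assert (HL := is_pseries_lin _ _ (-1) _ _ _ (is_pseries_shift _ _ _ H1) H1).
apply is_pseries_unique in HL.
rewrite (PSeries_ext _ flux_coef) in HL; [unfold ellK_flux; lra|].
intros [|n]; [unfold flux_coef; simpl; ring|].
assert (Hn := pos_INR n); unfold ellK_coef; rewrite S_INR; simpl flux_coef; simpl cbin.
field; lra.
Qed.

Lemma is_derive_ellK_series m : Rabs m < 1 -> m <> 0 ->
  is_derive ellK_series m (ellK_flux m / (m * (1 - m))).
Proof.
intros Hm Hm0; evar_last; [apply is_derive_bounded_PSeries; [apply Rabs_ellK_coef | exact Hm]|].
rewrite ellK_flux_eq by exact Hm; apply Rabs_def2 in Hm; field; lra.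
Qed.

Lemma is_derive_ellK_flux m : Rabs m < 1 -> is_derive ellK_flux m (ellK_series m / 4).
Proof.
intros Hm; evar_last; [apply is_derive_bounded_PSeries; [apply Rabs_flux_coef | exact Hm]|].
transitivity (/ 4 * PSeries ellK_coef m); [|unfold ellK_series; field].
rewrite <- PSeries_scal; apply PSeries_ext; intros n.
unfold PS_derive, PS_scal, ellK_coef, scal; simpl; unfold mult; simpl flux_coef.
change (match n with O => 1 | S _ => INR n + 1 end) with (INR (S n)); rewrite S_INR.
assert (Hn := pos_INR n); simpl; field; lra.
Qed.

(** With U = S(4 m (1 - m)), Z = m (1 - m) U', and W half of [cube_aux] at 4 m (1 - m),
    the formula U = y^2 amounts to Z = 2 y g and W = g^2. The pairing W y^2 - Z y g + U g^2
    has zero derivative and vanishes at 0. Together with the first integral Z^2 = 4 U W this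
    gives (Z y - 2 U g)^2 = 0, so that U / y^2 has zero derivative and equals its value 1 at
    0. *)
Lemma clausen_PSeries m : -1 < 4 * m * (1 - m) -> m < 1 / 2 ->
  cube_series (4 * m * (1 - m)) = ellK_series m ^ 2.
Proof.
intros Hz Hm.
assert (Hin : forall x, Rmin 0 m <= x <= Rmax 0 m -> Rabs x < 1 /\ Rabs (4 * x * (1 - x)) < 1).
{ intros x Hx.
  assert (-1 < x < 1 / 2) by (revert Hx; unfold Rmin, Rmax; destruct (Rle_dec 0 m); split; nra).
  split; apply Rabs_def1; try nra.
  revert Hx; unfold Rmin, Rmax; destruct (Rle_dec 0 m); nra. }
assert (DU : forall x, Rabs (4 * x * (1 - x)) < 1 -> x <> 0 -> x <> 1 ->
  is_derive (fun x => cube_series (4 * x * (1 - x))) x ((1 - 2 * x) * cube_theta (4 * x * (1 - x)) / (x * (1 - x)))).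
{ intros x Hx Hx0 Hx1; evar_last.
  - apply (is_derive_comp cube_series (fun x => 4 * x * (1 - x))); [apply is_derive_cube_series, Hx|].
    auto_derive; [exact I | reflexivity].
  - unfold cube_theta, scal; simpl; unfold mult; simpl; field; split; lra. }
assert (DV : forall x, Rabs (4 * x * (1 - x)) < 1 ->
  is_derive (fun x => cube_aux (4 * x * (1 - x))) x ((1 - 2 * x) * cube_theta (4 * x * (1 - x)) / 2)).
{ intros x Hx; evar_last.
  - apply (is_derive_comp cube_aux (fun x => 4 * x * (1 - x))); [apply is_derive_cube_aux, Hx|].
    auto_derive; [exact I | reflexivity].
  - unfold scal; simpl; unfold mult; simpl; field. }
assert (DZ : forall x, Rabs (4 * x * (1 - x)) < 1 -> x <> 0 -> x <> 1 ->
  is_derive (fun x => (1 - 2 * x) * cube_theta (4 * x * (1 - x))) x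
    (cube_aux (4 * x * (1 - x)) / (x * (1 - x)) + cube_series (4 * x * (1 - x)) / 2)).
{ intros x Hx Hx0 Hx1; evar_last.
  - apply (is_derive_mult (fun x => 1 - 2 * x) (fun x => cube_theta (4 * x * (1 - x))));
      [auto_derive; [exact I | reflexivity] | | intros; apply Rmult_comm].
    apply (is_derive_comp cube_theta (fun x => 4 * x * (1 - x))); [apply is_derive_cube_theta, Hx|].
    auto_derive; [exact I | reflexivity].
  - unfold scal, plus; simpl; unfold mult; simpl.
    assert (O := cube_series_ode _ Hx); set (z := 4 * x * (1 - x)) in *.
    apply Rmult_eq_reg_l with (x * (1 - x)); [|apply Rmult_integral_contrapositive; lra].
    transitivity ((1 - z) * (z * dcube_theta z) - z / 2 * cube_theta z); [unfold z; field|].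
    rewrite O; unfold z; field; split; lra. }
assert (N0 : forall x, Rmin 0 m < x < Rmax 0 m -> x <> 0 /\ x <> 1).
{ intros x Hx; revert Hx; unfold Rmin, Rmax; destruct (Rle_dec 0 m); lra. }
assert (C : forall f : R -> R, (forall z, Rabs z < 1 -> ex_derive f z) ->
  forall x, Rmin 0 m <= x <= Rmax 0 m -> continuous (fun x => f (4 * x * (1 - x))) x).
{ intros f Hf x Hx; apply (continuous_comp (fun x => 4 * x * (1 - x)) f).
  - apply (ex_derive_continuous (V := R_NormedModule)); auto_derive; exact I.
  - apply (ex_derive_continuous f), Hf, Hin, Hx. }
assert (CU := C cube_series ltac:(intros; eexists; apply is_derive_cube_series; assumption)).
assert (CS1 := C cube_theta ltac:(intros; eexists; apply is_derive_cube_theta; assumption)).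
assert (CV := C cube_aux ltac:(intros; eexists; apply is_derive_cube_aux; assumption)).
assert (Cy : forall x, Rmin 0 m <= x <= Rmax 0 m -> continuous ellK_series x)
  by (intros x Hx; apply continuous_PSeries; [apply Rabs_ellK_coef | apply Hin, Hx]).
assert (Cg : forall x, Rmin 0 m <= x <= Rmax 0 m -> continuous ellK_flux x)
  by (intros x Hx; apply continuous_PSeries; [apply Rabs_flux_coef | apply Hin, Hx]).
set (U := fun x : R => cube_series (4 * x * (1 - x))) in *.
set (V := fun x => cube_aux (4 * x * (1 - x))) in *.
set (Z := fun x => (1 - 2 * x) * cube_theta (4 * x * (1 - x))) in *.
assert (CZ : forall x, Rmin 0 m <= x <= Rmax 0 m -> continuous Z x).
{ intros x Hx; apply (continuous_mult (fun x => 1 - 2 * x) (fun x => cube_theta (4 * x * (1 - x)))).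
  - apply (ex_derive_continuous (V := R_NormedModule)); auto_derive; exact I.
  - apply CS1, Hx. }
(* the pairing of (U, Z, W) with the square of (y, g) is constant *)
assert (WR : forall x, Rmin 0 m <= x <= Rmax 0 m ->
  V x / 2 * ellK_series x ^ 2 - Z x * ellK_series x * ellK_flux x + U x * ellK_flux x ^ 2 = 0).
{ intros x Hx.
  transitivity (V 0 / 2 * ellK_series 0 ^ 2 - Z 0 * ellK_series 0 * ellK_flux 0 + U 0 * ellK_flux 0 ^ 2).
  2: { unfold V, Z, cube_aux, cube_theta, ellK_flux; replace (4 * 0 * (1 - 0)) with 0 by ring; rewrite !PSeries_0.
       simpl; field. }
  assert (Hsub : forall t, Rmin 0 x <= t <= Rmax 0 x -> Rmin 0 m <= t <= Rmax 0 m)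
    by (intros t; revert Hx; unfold Rmin, Rmax; destruct (Rle_dec 0 m), (Rle_dec 0 x); lra).
  assert (Hsub' : forall t, Rmin 0 x < t < Rmax 0 x -> Rmin 0 m < t < Rmax 0 m)
    by (intros t; revert Hx; unfold Rmin, Rmax; destruct (Rle_dec 0 m), (Rle_dec 0 x); lra).
  apply (eq_of_zero_derive (fun x => V x / 2 * ellK_series x ^ 2 - Z x * ellK_series x * ellK_flux x + U x * ellK_flux x ^ 2));
    intros t Ht.
  - apply Hsub' in Ht; destruct (N0 t Ht) as [Ht0 Ht1].
    destruct (Hin t ltac:(lra)) as [Htm Htz].
    assert (D1 : is_derive U t _) by exact (DU t Htz Ht0 Ht1).
    assert (D2 : is_derive V t _) by exact (DV t Htz).
    assert (D3 : is_derive Z t _) by exact (DZ t Htz Ht0 Ht1).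
    assert (D4 := is_derive_ellK_series t Htm Ht0); assert (D5 := is_derive_ellK_flux t Htm).
    assert (X1 : Derive (fun y => U y) t = _) by exact (is_derive_unique _ _ _ D1).
    assert (X2 : Derive (fun y => V y) t = _) by exact (is_derive_unique _ _ _ D2).
    assert (X3 : Derive (fun y => Z y) t = _) by exact (is_derive_unique _ _ _ D3).
    assert (X4 : Derive (fun y => ellK_series y) t = _) by exact (is_derive_unique _ _ _ D4).
    assert (X5 : Derive (fun y => ellK_flux y) t = _) by exact (is_derive_unique _ _ _ D5).
    change (cube_series (4 * t * (1 - t))) with (U t) in *; change (cube_aux (4 * t * (1 - t))) with (V t) in *.
    change ((1 - 2 * t) * cube_theta (4 * t * (1 - t))) with (Z t) in *.
    clearbody U V Z.
    auto_derive; [repeat split; auto; eexists; eassumption|].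
    rewrite X1, X2, X3, X4, X5; field; split; lra.
  - apply Hsub in Ht.
    assert (P : forall f g : R -> R, continuous f t -> continuous g t -> continuous (fun x => f x * g x) t)
      by (intros f g Hf Hg; exact (continuous_mult f g t Hf Hg)).
    assert (P2 : forall f : R -> R, continuous f t -> continuous (fun x => f x ^ 2) t)
      by (intros f Hf; apply (P f (fun x => f x * 1)), P; auto using continuous_const).
    apply (continuous_plus (fun x => V x / 2 * ellK_series x ^ 2 - Z x * ellK_series x * ellK_flux x) (fun x => U x * ellK_flux x ^ 2));
      [apply (continuous_minus (fun x => V x / 2 * ellK_series x ^ 2) (fun x => Z x * ellK_series x * ellK_flux x))|].
    + apply (P (fun x => V x / 2) (fun x => ellK_series x ^ 2)); auto.
      apply (P V (fun _ => / 2)); auto using continuous_const.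
    + apply (P (fun x => Z x * ellK_series x) ellK_flux); auto.
    + apply (P U (fun x => ellK_flux x ^ 2)); auto. }
assert (ZU : forall x, Rmin 0 m <= x <= Rmax 0 m -> Z x * ellK_series x = 2 * U x * ellK_flux x).
{ intros x Hx; assert (HW := WR x Hx).
  assert (HI := cube_series_invariant _ (proj2 (Hin x Hx))).
  assert (HI' : Z x ^ 2 = 2 * U x * V x).
  { unfold U, V; rewrite <- HI; unfold Z; ring. }
  assert (Q : (Z x * ellK_series x - 2 * U x * ellK_flux x) ^ 2 = 0).
  { transitivity (Z x ^ 2 * ellK_series x ^ 2 - 4 * U x * (Z x * ellK_series x * ellK_flux x - U x * ellK_flux x ^ 2)); [ring|].
    rewrite HI'; replace (Z x * ellK_series x * ellK_flux x - U x * ellK_flux x ^ 2) with (V x / 2 * ellK_series x ^ 2) by lra.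
    field. }
  assert (Q' : Z x * ellK_series x - 2 * U x * ellK_flux x = 0).
  { destruct (Req_dec (Z x * ellK_series x - 2 * U x * ellK_flux x) 0) as [E | E]; [exact E|].
    exfalso; apply (pow_nonzero _ 2) in E; contradiction. }
  lra. }
assert (Py : forall x, Rmin 0 m <= x <= Rmax 0 m -> 0 < ellK_series x).
{ intros x Hx; destruct (Hin x Hx) as [Hx1 _].
  assert (Hpi := PI2_pos); assert (HK := ellK_pos x ltac:(apply Rabs_def2 in Hx1; lra)).
  rewrite ellK_PSeries in HK by exact Hx1; fold (ellK_series x) in HK; nra. }
(* U / y^2 is constant; y > 0 comes from the integral defining K *)
assert (R : U m / ellK_series m ^ 2 = U 0 / ellK_series 0 ^ 2).
{ apply (eq_of_zero_derive (fun x => U x / ellK_series x ^ 2)); intros t Ht.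
  - destruct (N0 t Ht) as [Ht0 Ht1].
    destruct (Hin t ltac:(lra)) as [Htm Htz].
    assert (D1 : is_derive U t _) by exact (DU t Htz Ht0 Ht1); assert (D4 := is_derive_ellK_series t Htm Ht0).
    assert (X1 : Derive (fun y => U y) t = _) by exact (is_derive_unique _ _ _ D1).
    assert (X4 : Derive (fun y => ellK_series y) t = _) by exact (is_derive_unique _ _ _ D4).
    change ((1 - 2 * t) * cube_theta (4 * t * (1 - t))) with (Z t) in *.
    assert (HZ := ZU t ltac:(lra)); assert (HP := Py t ltac:(lra)).
    clearbody U V Z.
    auto_derive; [repeat split; auto; try (eexists; eassumption); apply Rgt_not_eq; nra|].
    rewrite X1, X4.
    transitivity ((Z t * ellK_series t - 2 * U t * ellK_flux t) / (t * (1 - t) * ellK_series t ^ 3)); [field; repeat split; lra|].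
    rewrite HZ; field; repeat split; lra.
  - assert (HP := Py t Ht).
    apply (continuous_mult U (fun x => / ellK_series x ^ 2)); [apply CU, Ht|].
    apply (continuous_comp (fun x => ellK_series x ^ 2) Rinv).
    + apply (continuous_mult ellK_series (fun x => ellK_series x * 1)); [apply Cy, Ht|].
      apply (continuous_mult ellK_series (fun _ => 1)); [apply Cy, Ht | apply continuous_const].
    + apply continuous_Rinv; apply Rgt_not_eq; simpl; nra. }
assert (U0 : U 0 / ellK_series 0 ^ 2 = 1).
{ unfold U, cube_series, ellK_series; replace (4 * 0 * (1 - 0)) with 0 by ring; rewrite !PSeries_0.
  unfold cube_coef, ellK_coef; simpl; field. }
assert (HP := Py m ltac:(unfold Rmin, Rmax; destruct (Rle_dec 0 m); lra)).
change (cube_series (4 * m * (1 - m))) with (U m).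
rewrite U0 in R; apply Rmult_eq_reg_r with (/ ellK_series m ^ 2); [|apply Rinv_neq_0_compat, pow_nonzero; lra].
rewrite Rinv_r by (apply pow_nonzero; lra); exact R.
Qed.

Lemma ellK_clausen (m : R) : -1 < 4 * m * (1 - m) -> m < 1 / 2 ->
  ellK m ^ 2 = (PI / 2) ^ 2 * PSeries cube_coef (4 * m * (1 - m)).
Proof.
intros Hz Hm; rewrite clausen_PSeries by assumption.
rewrite ellK_PSeries; [unfold ellK_series; ring | apply Rabs_def1; nra].
Qed.

(** * Legendre polynomials and their generating function *)

(** The second component is d_n = s P_n - P_(n-1). In the coordinates (sqrt (1 - s^2) P,
    d) a step shrinks d by the factor n / (n + 1) and then rotates, which is what bounds P_n
    on [-1, 1]. *)
Fixpoint legendre_pair (s : R) (n : nat) : R * R :=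
  match n with
  | O => (1, 0)
  | S k => let (P, d) := legendre_pair s k in
           let c := INR k / (INR k + 1) in
           (s * P + c * d, c * s * d - (1 - s ^ 2) * P)
  end.

Definition legendre (s : R) (n : nat) : R := fst (legendre_pair s n).

(** The quadratic form (1 - s^2) P^2 + d^2 does not increase with n. It degenerates when
    s^2 = 1, but then it forces d = 0 and P_(n+1) = s P_n. *)
Lemma legendre_bound (s : R) (n : nat) : -1 <= s <= 1 -> Rabs (legendre s n) <= 1.
Proof.
intros Hs; unfold legendre.
assert (Q : 0 <= 1 - s ^ 2) by nra.
enough (H : fst (legendre_pair s n) ^ 2 <= 1 /\
  (1 - s ^ 2) * fst (legendre_pair s n) ^ 2 + snd (legendre_pair s n) ^ 2 <= 1 - s ^ 2)
  by (apply Rabs_le; nra).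
induction n as [|n IH]; [simpl; nra|].
assert (Hn := pos_INR n).
simpl legendre_pair; destruct (legendre_pair s n) as [P d]; simpl fst in *; simpl snd in *.
destruct IH as [H1 H2].
set (c := INR n / (INR n + 1)).
assert (Hc : 0 <= c <= 1).
{ unfold c; split; [apply Rdiv_le_0_compat; lra|].
  apply Rmult_le_reg_r with (INR n + 1); [lra|].
  unfold Rdiv; rewrite Rmult_assoc, Rinv_l; lra. }
assert (E : (1 - s ^ 2) * (s * P + c * d) ^ 2 + (c * s * d - (1 - s ^ 2) * P) ^ 2
            = (1 - s ^ 2) * P ^ 2 + c ^ 2 * d ^ 2) by ring.
assert (H : (1 - s ^ 2) * (s * P + c * d) ^ 2 + (c * s * d - (1 - s ^ 2) * P) ^ 2 <= 1 - s ^ 2).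
{ rewrite E; assert (c ^ 2 <= 1) by nra; assert (Hd := pow2_ge_0 d); nra. }
split; [|exact H].
destruct (Rle_lt_or_eq_dec _ _ Q) as [Hlt | Heq].
- assert (H0 := pow2_ge_0 (c * s * d - (1 - s ^ 2) * P)); nra.
- rewrite <- Heq in H2; assert (Hd : d = 0) by nra.
  rewrite Hd, Rmult_0_r, Rplus_0_r, Rpow_mult_distr; nra.
Qed.

Lemma legendre_rec (s : R) (n : nat) :
  (INR n + 2) * legendre s (S (S n)) = (2 * INR n + 3) * s * legendre s (S n) - (INR n + 1) * legendre s n.
Proof.
assert (Hn := pos_INR n); unfold legendre.
change (legendre_pair s (S (S n))) with
  (let (P, d) := legendre_pair s (S n) in
   let c := INR (S n) / (INR (S n) + 1) in
   (s * P + c * d, c * s * d - (1 - s ^ 2) * P)).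
rewrite S_INR; simpl (legendre_pair s (S n)); destruct (legendre_pair s n) as [P d].
cbv zeta beta iota; simpl fst; field; lra.
Qed.

Lemma legendre_0 s : legendre s 0 = 1. Proof. reflexivity. Qed.

Lemma legendre_1 s : legendre s 1 = s. Proof. unfold legendre; simpl; field. Qed.

Definition leg_even (s : R) (k : nat) : R := legendre s (2 * k).

Definition leg_odd (s : R) (k : nat) : R := legendre s (S (2 * k)).

Lemma leg_even_rec s k :
  (2 * INR k + 2) * leg_even s (S k) = (4 * INR k + 3) * s * leg_odd s k - (2 * INR k + 1) * leg_even s k.
Proof.
assert (H := legendre_rec s (2 * k)); rewrite mult_INR in H; simpl INR in H.
unfold leg_even, leg_odd; replace (2 * S k)%nat with (S (S (2 * k))) by lia; lra.
Qed.

Lemma leg_odd_rec s k :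
  (2 * INR k + 3) * leg_odd s (S k) = (4 * INR k + 5) * s * leg_even s (S k) - (2 * INR k + 2) * leg_odd s k.
Proof.
assert (H := legendre_rec s (S (2 * k))); rewrite S_INR, mult_INR in H; simpl INR in H.
unfold leg_even, leg_odd; replace (2 * S k)%nat with (S (S (2 * k))) by lia; lra.
Qed.

(** The generating series g(t) of the P_n(s), split as g = X + t Y with X, Y series in p
    = t^2. Keeping p as the variable allows negative p, that is imaginary t. *)
Definition gen_even (s p : R) : R := PSeries (leg_even s) p.

Definition gen_odd (s p : R) : R := PSeries (leg_odd s) p.

Definition dgen_even (s p : R) : R := PSeries (PS_derive (leg_even s)) p.

Definition dgen_odd (s p : R) : R := PSeries (PS_derive (leg_odd s)) p.

Lemma Rabs_leg_even s : -1 <= s <= 1 -> forall n, Rabs (leg_even s n) <= 1.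
Proof. intros Hs n; apply legendre_bound, Hs. Qed.

Lemma Rabs_leg_odd s : -1 <= s <= 1 -> forall n, Rabs (leg_odd s n) <= 1.
Proof. intros Hs n; apply legendre_bound, Hs. Qed.

Lemma is_derive_gen_even s p : -1 <= s <= 1 -> Rabs p < 1 ->
  is_derive (gen_even s) p (dgen_even s p).
Proof. intros Hs Hp; apply is_derive_bounded_PSeries; [apply Rabs_leg_even|]; assumption. Qed.

Lemma is_derive_gen_odd s p : -1 <= s <= 1 -> Rabs p < 1 -> is_derive (gen_odd s) p (dgen_odd s p).
Proof. intros Hs Hp; apply is_derive_bounded_PSeries; [apply Rabs_leg_odd|]; assumption. Qed.

Lemma gen_even_0 s : gen_even s 0 = 1. Proof. unfold gen_even; rewrite PSeries_0; reflexivity. Qed.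

Lemma gen_odd_0 s : gen_odd s 0 = s.
Proof. unfold gen_odd; rewrite PSeries_0; apply legendre_1. Qed.

(** This and [leg_ode_odd] are the even and odd parts of (1 - 2 s t + t^2) g' = (s - t)
    g. *)
Lemma leg_ode_even s p : -1 <= s <= 1 -> Rabs p < 1 ->
  2 * (1 + p) * dgen_even s p - 4 * s * p * dgen_odd s p = 3 * s * gen_odd s p - gen_even s p.
Proof.
intros Hs Hp.
assert (HE := is_pseries_bounded _ _ (Rabs_leg_even s Hs) Hp); assert (HO := is_pseries_bounded _ _ (Rabs_leg_odd s Hs) Hp).
assert (HE1 := is_pseries_PS_derive _ _ (Rabs_leg_even s Hs) Hp); assert (HO1 := is_pseries_theta _ _ (Rabs_leg_odd s Hs) Hp).
assert (HE1' := is_pseries_theta _ _ (Rabs_leg_even s Hs) Hp).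
assert (HL := is_pseries_lin _ _ 2 _ _ _ HE1 (is_pseries_lin _ _ 2 _ _ _ HE1'
   (is_pseries_lin _ _ (-4 * s) _ _ _ HO1 (is_pseries_lin _ _ (- 3 * s) _ _ _ HO HE)))).
apply is_pseries_unique in HL.
rewrite (PSeries_ext _ (fun _ => 0)), PSeries_const_0 in HL; [unfold gen_even, gen_odd, dgen_even, dgen_odd; lra|].
intros n; unfold PS_derive; rewrite S_INR; assert (H := leg_even_rec s n); lra.
Qed.

Lemma leg_ode_odd s p : -1 <= s <= 1 -> Rabs p < 1 ->
  2 * p * (1 + p) * dgen_odd s p - 4 * s * p * dgen_even s p = s * gen_even s p - (1 + 2 * p) * gen_odd s p.
Proof.
intros Hs Hp.
assert (HE := is_pseries_bounded _ _ (Rabs_leg_even s Hs) Hp); assert (HO := is_pseries_bounded _ _ (Rabs_leg_odd s Hs) Hp).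
assert (HO1 := is_pseries_theta _ _ (Rabs_leg_odd s Hs) Hp); assert (HE1 := is_pseries_theta _ _ (Rabs_leg_even s Hs) Hp).
assert (HL := is_pseries_lin _ _ 2 _ _ _ HO1
   (is_pseries_lin _ _ 2 _ _ _ (is_pseries_shift _ _ _ HO1)
   (is_pseries_lin _ _ (-4 * s) _ _ _ HE1 (is_pseries_lin _ _ (- s) _ _ _ HE
   (is_pseries_lin _ _ 2 _ _ _ (is_pseries_shift _ _ _ HO) HO))))).
apply is_pseries_unique in HL.
rewrite (PSeries_ext _ (fun _ => 0)), PSeries_const_0 in HL; [unfold gen_even, gen_odd, dgen_even, dgen_odd; lra|].
intros [|n].
- unfold leg_even, leg_odd; simpl (2 * 0)%nat; rewrite legendre_0, legendre_1; simpl; ring.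
- rewrite S_INR; assert (H := leg_odd_rec s n); lra.
Qed.

(** Even part of g^2 (1 - 2 s t + t^2) = 1. *)
Lemma leg_invariant_re s p : -1 <= s <= 1 -> Rabs p < 1 ->
  (gen_even s p ^ 2 + p * gen_odd s p ^ 2) * (1 + p) - 4 * s * p * gen_even s p * gen_odd s p = 1.
Proof.
intros Hs Hp.
assert (D : forall y, Rabs y < 1 -> is_derive
  (fun p => (gen_even s p ^ 2 + p * gen_odd s p ^ 2) * (1 + p) - 4 * s * p * gen_even s p * gen_odd s p) y 0).
{ intros y Hy.
  assert (D1 : is_derive (gen_even s) y (dgen_even s y)) by (apply is_derive_gen_even; assumption).
  assert (D2 : is_derive (gen_odd s) y (dgen_odd s y)) by (apply is_derive_gen_odd; assumption).
  assert (X1 : Derive (fun y => gen_even s y) y = _) by exact (is_derive_unique _ _ _ D1).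
  assert (X2 : Derive (fun y => gen_odd s y) y = _) by exact (is_derive_unique _ _ _ D2).
  assert (O1 := leg_ode_even s y Hs Hy); assert (O2 := leg_ode_odd s y Hs Hy).
  auto_derive; [repeat split; auto; eexists; eassumption|].
  rewrite X1, X2.
  transitivity (gen_even s y * (2 * (1 + y) * dgen_even s y - 4 * s * y * dgen_odd s y)
    + gen_odd s y * (2 * y * (1 + y) * dgen_odd s y - 4 * s * y * dgen_even s y)
    + (1 + y) * gen_odd s y ^ 2 + gen_even s y ^ 2 + y * gen_odd s y ^ 2 - 4 * s * gen_even s y * gen_odd s y); [ring|].
  rewrite O1, O2; ring. }
transitivity ((gen_even s 0 ^ 2 + 0 * gen_odd s 0 ^ 2) * (1 + 0) - 4 * s * 0 * gen_even s 0 * gen_odd s 0).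
- apply (eq_of_zero_derive (fun p => (gen_even s p ^ 2 + p * gen_odd s p ^ 2) * (1 + p) - 4 * s * p * gen_even s p * gen_odd s p));
    intros y Hy.
  + apply D, (between_0_lt1 p Hp); lra.
  + apply (ex_derive_continuous (V := R_NormedModule)); eexists; apply D, (between_0_lt1 p Hp), Hy.
- rewrite gen_even_0, gen_odd_0; ring.
Qed.

(** Odd part of g^2 (1 - 2 s t + t^2) = 1, divided by 2 t. Restoring the factor t makes
    it a conserved quantity, whence the square times p in the proof. *)
Lemma leg_invariant_im s p : -1 <= s <= 1 -> Rabs p < 1 ->
  gen_even s p * gen_odd s p * (1 + p) = s * (gen_even s p ^ 2 + p * gen_odd s p ^ 2).
Proof.
intros Hs Hp.
set (G := fun p => gen_even s p * gen_odd s p * (1 + p) - s * (gen_even s p ^ 2 + p * gen_odd s p ^ 2)).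
enough (E : G p = 0) by (unfold G in E; lra).
destruct (Req_dec p 0) as [-> | Hp0].
{ unfold G; rewrite gen_even_0, gen_odd_0; ring. }
assert (D : forall y, Rabs y < 1 -> is_derive (fun p => p * G p ^ 2) y 0).
{ intros y Hy.
  assert (D1 : is_derive (gen_even s) y (dgen_even s y)) by (apply is_derive_gen_even; assumption).
  assert (D2 : is_derive (gen_odd s) y (dgen_odd s y)) by (apply is_derive_gen_odd; assumption).
  assert (X1 : Derive (fun y => gen_even s y) y = _) by exact (is_derive_unique _ _ _ D1).
  assert (X2 : Derive (fun y => gen_odd s y) y = _) by exact (is_derive_unique _ _ _ D2).
  assert (O1 := leg_ode_even s y Hs Hy); assert (O2 := leg_ode_odd s y Hs Hy).
  unfold G.
  auto_derive; [repeat split; auto; eexists; eassumption|].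
  rewrite X1, X2.
  transitivity ((gen_even s y * gen_odd s y * (1 + y) - s * (gen_even s y ^ 2 + y * gen_odd s y ^ 2)) *
   ((y * gen_odd s y) * (2 * (1 + y) * dgen_even s y - 4 * s * y * dgen_odd s y)
    + gen_even s y * (2 * y * (1 + y) * dgen_odd s y - 4 * s * y * dgen_even s y)
    + 2 * y * gen_even s y * gen_odd s y - 2 * s * y * gen_odd s y ^ 2 
    + (gen_even s y * gen_odd s y * (1 + y) - s * (gen_even s y ^ 2 + y * gen_odd s y ^ 2)))); [ring|].
  rewrite O1, O2; ring. }
assert (E : p * G p ^ 2 = 0 * G 0 ^ 2).
{ apply (eq_of_zero_derive (fun p => p * G p ^ 2)); intros y Hy.
  - apply D, (between_0_lt1 p Hp); lra.
  - apply (ex_derive_continuous (V := R_NormedModule)); eexists; apply D, (between_0_lt1 p Hp), Hy. }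
rewrite Rmult_0_l in E; apply Rmult_integral in E; destruct E as [E | E]; [contradiction|].
destruct (Req_dec (G p) 0) as [E' | E']; [exact E'|].
apply (pow_nonzero _ 2) in E'; contradiction.
Qed.

Lemma denom_pos s p : -1 <= s <= 1 -> Rabs p < 1 -> 0 < (1 + p) ^ 2 - 4 * p * s ^ 2.
Proof.
intros Hs Hp; apply Rabs_def2 in Hp.
assert (Hs2 : 0 <= s ^ 2 <= 1) by nra.
destruct (Rle_dec p 0) as [H | H].
- assert (p * s ^ 2 <= 0) by nra; nra.
- assert (p * s ^ 2 <= p) by nra; nra.
Qed.

(** ((1 - y)^(-1/2) + (1 + y)^(-1/2)) / 2 for z = y^2, the sum of the [cbin (2 * n) * z
    ^ n] near 0, written so as to make sense for all z < 1. *)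
Definition kernel (z : R) : R := sqrt ((1 + sqrt (1 - z)) / (2 * (1 - z))).

(** The two identities for X and Y give N = X^2 + p Y^2 and the square of D = X^2 - p
    Y^2. Both N and D, hence X, keep their sign between 0 and p, which selects the square
    roots. *)
Lemma gen_even_closed s p : -1 <= s <= 1 -> Rabs p < 1 ->
  sqrt (1 + p) * gen_even s p = kernel (4 * p * s ^ 2 / (1 + p) ^ 2).
Proof.
intros Hs Hp.
assert (Hp' := Rabs_def2 _ _ Hp).
set (w := fun p => 1 - 4 * p * s ^ 2 / (1 + p) ^ 2).
assert (F : forall y, Rmin 0 p <= y <= Rmax 0 p ->
  let N := gen_even s y ^ 2 + y * gen_odd s y ^ 2 in
  let D := gen_even s y ^ 2 - y * gen_odd s y ^ 2 in
  0 < w y /\ N * (1 + y) * w y = 1 /\ D ^ 2 = N ^ 2 * w y).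
{ intros y Hy N D.
  assert (Hy1 := between_0_lt1 p Hp y Hy); assert (Hy1' := Rabs_def2 _ _ Hy1).
  assert (R1 := leg_invariant_re s y Hs Hy1); assert (R2 := leg_invariant_im s y Hs Hy1).
  fold N in R1, R2.
  assert (Hd := denom_pos s y Hs Hy1).
  assert (E1 : gen_even s y * gen_odd s y = s * N / (1 + y)) by (rewrite <- R2; field; lra).
  assert (Ew : w y = ((1 + y) ^ 2 - 4 * y * s ^ 2) / (1 + y) ^ 2) by (unfold w; field; lra).
  repeat split.
  - rewrite Ew; apply Rdiv_lt_0_compat; [exact Hd | apply pow_lt; lra].
  - rewrite <- R1 at 2.
    replace (4 * s * y * gen_even s y * gen_odd s y) with (4 * s * y * (gen_even s y * gen_odd s y)) by ring.
    rewrite E1; unfold w; field; lra.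
  - transitivity (N ^ 2 - 4 * y * (gen_even s y * gen_odd s y) ^ 2); [unfold D, N; ring|].
    rewrite E1; unfold w; field; lra. }
assert (CE : forall y, Rmin 0 p <= y <= Rmax 0 p -> continuous (gen_even s) y).
{ intros y Hy; apply (ex_derive_continuous (gen_even s)); eexists.
  apply is_derive_gen_even; [exact Hs | apply (between_0_lt1 p Hp), Hy]. }
assert (CO : forall y, Rmin 0 p <= y <= Rmax 0 p -> continuous (gen_odd s) y).
{ intros y Hy; apply (ex_derive_continuous (gen_odd s)); eexists.
  apply is_derive_gen_odd; [exact Hs | apply (between_0_lt1 p Hp), Hy]. }
assert (C2 : forall (f : R -> R) y, continuous f y -> continuous (fun x => f x ^ 2) y).
{ intros f y Hf; apply (continuous_mult f (fun x => f x * 1)); [exact Hf|].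
  apply (continuous_mult f (fun _ => 1)); [exact Hf | apply continuous_const]. }
assert (PN : forall y, Rmin 0 p <= y <= Rmax 0 p -> 0 < gen_even s y ^ 2 + y * gen_odd s y ^ 2).
{ intros y Hy; destruct (F y Hy) as [Hw [HN _]].
  assert (Hy1' := Rabs_def2 _ _ (between_0_lt1 p Hp y Hy)).
  set (N := gen_even s y ^ 2 + y * gen_odd s y ^ 2) in *.
  destruct (Rlt_dec 0 N) as [H | H]; [exact H | exfalso].
  assert (Hyw : 0 < (1 + y) * w y) by (apply Rmult_lt_0_compat; lra); nra. }
assert (Hsub : forall y t, Rmin 0 p <= y <= Rmax 0 p -> Rmin 0 y <= t <= Rmax 0 y ->
  Rmin 0 p <= t <= Rmax 0 p)
  by (intros y t; unfold Rmin, Rmax; destruct (Rle_dec 0 p), (Rle_dec 0 y); lra).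
assert (PD : forall y, Rmin 0 p <= y <= Rmax 0 p -> 0 < gen_even s y ^ 2 - y * gen_odd s y ^ 2).
{ intros y Hy; apply (pos_of_nonzero (fun y => gen_even s y ^ 2 - y * gen_odd s y ^ 2)).
  - intros t Ht; apply (Hsub y t Hy) in Ht.
    apply (continuous_minus (fun y => gen_even s y ^ 2) (fun y => y * gen_odd s y ^ 2)).
    + apply C2, CE, Ht.
    + apply (continuous_mult (fun y => y) (fun y => gen_odd s y ^ 2)); [apply continuous_id | apply C2, CO, Ht].
  - intros t Ht E; apply (Hsub y t Hy) in Ht; destruct (F t Ht) as [Hw [_ HD]].
    assert (HN := PN t Ht); rewrite E in HD.
    set (N := gen_even s t ^ 2 + t * gen_odd s t ^ 2) in *.
    assert (0 < N ^ 2 * w t) by (apply Rmult_lt_0_compat; [apply pow_lt|]; lra).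
    lra.
  - rewrite gen_even_0; lra. }
assert (Ip : Rmin 0 p <= p <= Rmax 0 p) by (unfold Rmin, Rmax; destruct (Rle_dec 0 p); lra).
assert (PX : 0 < gen_even s p).
{ apply (pos_of_nonzero (gen_even s) p CE); [|rewrite gen_even_0; lra].
  intros y Hy E; assert (H1 := PN y Hy); assert (H2 := PD y Hy); rewrite E in H1, H2; lra. }
destruct (F p Ip) as [Hw [HN HD]]; assert (HPD := PD p Ip); assert (HPN := PN p Ip).
set (N := gen_even s p ^ 2 + p * gen_odd s p ^ 2) in *.
set (D := gen_even s p ^ 2 - p * gen_odd s p ^ 2) in *.
assert (ED : D = N * sqrt (w p)).
{ assert (Hsw : 0 < sqrt (w p)) by (apply sqrt_lt_R0, Hw).
  assert (Hss : sqrt (w p) * sqrt (w p) = w p) by (apply sqrt_sqrt; lra).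
  assert (Q : (D - N * sqrt (w p)) * (D + N * sqrt (w p)) = 0).
  { transitivity (D ^ 2 - N ^ 2 * (sqrt (w p) * sqrt (w p))); [ring|]; rewrite Hss; lra. }
  assert (0 < N * sqrt (w p)) by (apply Rmult_lt_0_compat; lra).
  apply Rmult_integral in Q; lra. }
unfold kernel; fold (w p).
symmetry; apply sqrt_lem_1.
- apply Rlt_le, Rdiv_lt_0_compat; [assert (Hsw := sqrt_pos (w p)); lra | lra].
- apply Rmult_le_pos; [apply sqrt_pos | lra].
- assert (Hsp : sqrt (1 + p) * sqrt (1 + p) = 1 + p) by (apply sqrt_sqrt; lra).
  transitivity ((sqrt (1 + p) * sqrt (1 + p)) * ((N + D) / 2)); [unfold N, D; field|].
  rewrite Hsp, ED.
  transitivity ((N * (1 + p) * w p) * (1 + sqrt (w p)) / (2 * w p)); [field; lra|].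
  rewrite HN; field; lra.
Qed.

(** * Coefficients of the Legendre polynomials and a Saalschuetz sum *)

(** Coefficient of s^(2j) in P_(2k), computed along the diagonals k - j constant so that
    it is 0 for j > k. *)
Fixpoint leg_even_coef (k j : nat) : R :=
  match k with
  | O => match j with O => 1 | S _ => 0 end
  | S k' => match j with
    | O => - (2 * INR k' + 1) / (2 * INR k' + 2) * leg_even_coef k' 0
    | S i => leg_even_coef k' i * ((2 * INR k' + 2 * INR i + 3) * (2 * INR k' + 2 * INR i + 1)
                        / ((2 * INR i + 2) * (2 * INR i + 1)))
    end
  end.

(** Coefficient of s^(2j+1) in P_(2k+1). *)
Definition leg_odd_coef (k j : nat) : R :=
  leg_even_coef k j * (2 * INR k + 2 * INR j + 1) / (2 * INR j + 1).

Lemma leg_even_coef_S0 k : leg_even_coef (S k) 0 =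
  - (2 * INR k + 1) / (2 * INR k + 2) * leg_even_coef k 0.
Proof. reflexivity. Qed.

Lemma leg_even_coef_SS k i : leg_even_coef (S k) (S i) =
  leg_even_coef k i * ((2 * INR k + 2 * INR i + 3) * (2 * INR k + 2 * INR i + 1)
                        / ((2 * INR i + 2) * (2 * INR i + 1))).
Proof. reflexivity. Qed.

Lemma leg_even_coef_zero k : forall j, (k < j)%nat -> leg_even_coef k j = 0.
Proof.
induction k as [|k IH]; intros [|j] Hj; try lia; [reflexivity|].
rewrite leg_even_coef_SS, IH by lia; ring.
Qed.

Lemma leg_even_coef_next k : forall j,
  leg_even_coef k (S j) = - leg_even_coef k j * ((2 * INR k + 2 * INR j + 1) * (INR k - INR j) / ((2 * INR j + 1) * (INR j + 1))).
Proof.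
induction k as [|k IH]; intros j; assert (Hj := pos_INR j).
- destruct j as [|j]; simpl leg_even_coef; [simpl; field | ring].
- destruct j as [|i].
  + rewrite leg_even_coef_SS, leg_even_coef_S0, S_INR; simpl (INR 0); assert (Hk := pos_INR k); field; lra.
  + rewrite !leg_even_coef_SS, IH, !S_INR; assert (Hi := pos_INR i); field; lra.
Qed.

Lemma leg_even_coef_down k : forall j,
  leg_even_coef k j * (2 * INR k + 2 * INR j + 1) = - 2 * (INR k + 1 - INR j) * leg_even_coef (S k) j.
Proof.
intros [|i]; assert (Hk := pos_INR k).
- rewrite leg_even_coef_S0; simpl (INR 0); field; lra.
- rewrite leg_even_coef_SS, leg_even_coef_next, S_INR; assert (Hi := pos_INR i); field; lra.
Qed.

Lemma leg_odd_coef_rec k j :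
  (2 * INR k + 3) * leg_odd_coef (S k) j = (4 * INR k + 5) * leg_even_coef (S k) j - (2 * INR k + 2) * leg_odd_coef k j.
Proof.
assert (Hj := pos_INR j); unfold leg_odd_coef; rewrite (leg_even_coef_down k j), S_INR; field; lra.
Qed.

Lemma leg_even_coef_rec k j :
  (2 * INR k + 2) * leg_even_coef (S k) (S j) = (4 * INR k + 3) * leg_odd_coef k j - (2 * INR k + 1) * leg_even_coef k (S j).
Proof.
assert (Hj := pos_INR j); unfold leg_odd_coef; rewrite leg_even_coef_SS, leg_even_coef_next; field; lra.
Qed.

Lemma legendre_coef (s : R) (k : nat) :
  leg_even s k = sum_f_R0 (fun j => leg_even_coef k j * (s ^ 2) ^ j) k /\
  leg_odd s k = s * sum_f_R0 (fun j => leg_odd_coef k j * (s ^ 2) ^ j) k.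
Proof.
induction k as [|k [IHe IHo]].
{ split; [simpl; rewrite Rmult_1_r; reflexivity|].
  unfold leg_odd; simpl (2 * 0)%nat; rewrite legendre_1; unfold leg_odd_coef; simpl; field. }
assert (Hk := pos_INR k).
(* The even recurrence shifts j by one; the sums are padded by a vanishing last term. *)
assert (Ee : leg_even s (S k) = sum_f_R0 (fun j => leg_even_coef (S k) j * (s ^ 2) ^ j) (S k)).
{ apply Rmult_eq_reg_l with (2 * INR k + 2); [|lra].
  rewrite leg_even_rec, IHe, IHo, sum_S_first.
  rewrite <- (sum_zero_ext (fun j => leg_even_coef k j * (s ^ 2) ^ j) k (S k)), sum_S_first
    by (try lia; intros j Hj; rewrite leg_even_coef_zero by lia; ring).
  rewrite (sum_eq (fun j => leg_even_coef (S k) (S j) * (s ^ 2) ^ S j)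
    (fun j => (4 * INR k + 3) * s ^ 2 / (2 * INR k + 2) * (leg_odd_coef k j * (s ^ 2) ^ j)
              + - (2 * INR k + 1) / (2 * INR k + 2) * (leg_even_coef k (S j) * (s ^ 2) ^ S j))).
  - rewrite sum_lin, leg_even_coef_S0; simpl pow; field; lra.
  - intros j _; apply Rmult_eq_reg_l with (2 * INR k + 2); [|lra].
    transitivity (((2 * INR k + 2) * leg_even_coef (S k) (S j)) * (s ^ 2) ^ S j); [ring|].
    rewrite leg_even_coef_rec, <- (tech_pow_Rmult (s ^ 2) j); field; lra. }
split; [exact Ee|].
apply Rmult_eq_reg_l with (2 * INR k + 3); [|lra].
rewrite leg_odd_rec, Ee, IHo.
rewrite <- (sum_zero_ext (fun j => leg_odd_coef k j * (s ^ 2) ^ j) k (S k))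
  by (try lia; intros j Hj; unfold leg_odd_coef; rewrite leg_even_coef_zero by lia; unfold Rdiv; ring).
rewrite (sum_eq (fun j => leg_odd_coef (S k) j * (s ^ 2) ^ j)
  (fun j => (4 * INR k + 5) / (2 * INR k + 3) * (leg_even_coef (S k) j * (s ^ 2) ^ j)
            + - (2 * INR k + 2) / (2 * INR k + 3) * (leg_odd_coef k j * (s ^ 2) ^ j))).
- rewrite sum_lin; field; lra.
- intros j _; apply Rmult_eq_reg_l with (2 * INR k + 3); [|lra].
  transitivity (((2 * INR k + 3) * leg_odd_coef (S k) j) * (s ^ 2) ^ j); [ring|].
  rewrite leg_odd_coef_rec; field; lra.
Qed.

(** Zeilberger's method: this combination of the k-th and (k+1)-st summands is a
    difference in j. *)
Lemma saalschuetz_telescope (k N : nat) :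
  sum_f_R0 (fun j => 8 * (INR k + 1) ^ 3 * (leg_even_coef (S k) j * cbin j ^ 2)
                     + (2 * INR k + 1) ^ 3 * (leg_even_coef k j * cbin j ^ 2)) N
  = - (4 * INR k + 3) * (2 * INR k + 2 * INR N + 1) * (2 * INR N + 1) * (leg_even_coef k N * cbin N ^ 2).
Proof.
assert (Hk := pos_INR k).
induction N as [|N IH].
- cbn [sum_f_R0]; rewrite leg_even_coef_S0; simpl cbin; simpl (INR 0); field; lra.
- rewrite tech5, IH, leg_even_coef_SS, leg_even_coef_next, S_INR.
  assert (HN := pos_INR N); simpl cbin; field; lra.
Qed.

(** The Pfaff-Saalschuetz evaluation of 3F2(-k, k + 1/2, 1/2; 1, 1; 1). *)
Lemma saalschuetz (k : nat) :
  sum_f_R0 (fun j => leg_even_coef k j * cbin j ^ 2) k = (-1) ^ k * cbin k ^ 3.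
Proof.
induction k as [|k IH]; [simpl; ring|].
assert (Hk := pos_INR k).
assert (T := saalschuetz_telescope k (S k)).
rewrite (leg_even_coef_zero k (S k)) in T by lia.
rewrite sum_lin in T.
rewrite (sum_zero_ext (fun j => leg_even_coef k j * cbin j ^ 2) k (S k)), IH in T
  by (try lia; intros j Hj; rewrite leg_even_coef_zero by lia; ring).
apply Rmult_eq_reg_l with (8 * (INR k + 1) ^ 3); [|apply Rmult_integral_contrapositive; split; [lra | apply pow_nonzero; lra]].
transitivity (- ((2 * INR k + 1) ^ 3 * ((-1) ^ k * cbin k ^ 3))); [lra|].
simpl cbin; rewrite <- (tech_pow_Rmult (-1) k); field; lra.
Qed.

(** * Averaging polynomials over two arcsine laws *)

(** As [cbin n] is the n-th moment of sin^2 t for t uniform on [0, PI/2], F x is the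
    mean of f (x sin^2 t sin^2 t') over independent t, t'. The pointwise equations make the
    relation insensitive to how the functions are written. *)
Inductive arcsine_pair : (R -> R) -> (R -> R) -> Prop :=
| arcsine_mono n f F : (forall x, f x = x ^ n) -> (forall x, F x = cbin n ^ 2 * x ^ n) -> arcsine_pair f F
| arcsine_lin c f F g G h H : arcsine_pair f F -> arcsine_pair g G ->
    (forall x, h x = c * f x + g x) -> (forall x, H x = c * F x + G x) -> arcsine_pair h H.

Lemma arcsine_scal c f F : arcsine_pair f F -> arcsine_pair (fun x => c * f x) (fun x => c * F x).
Proof. intros H; apply (arcsine_lin (c - 1) f F f F); auto; intros x; ring. Qed.

Lemma arcsine_sum (c : nat -> R) (f F : nat -> R -> R) (N : nat) :
  (forall k, arcsine_pair (f k) (F k)) ->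
  arcsine_pair (fun x => sum_f_R0 (fun k => c k * f k x) N) (fun x => sum_f_R0 (fun k => c k * F k x) N).
Proof.
intros H; induction N as [|N IH]; simpl; [apply arcsine_scal, H|].
eapply arcsine_lin; [apply (H (S N)) | apply IH | |]; intros x; simpl; rewrite Rplus_comm; reflexivity.
Qed.

Lemma arcsine_pair_int f F : arcsine_pair f F -> exists G : R -> R,
  (forall x, is_RInt (fun t => f (x * sin t ^ 2)) 0 (PI / 2) (PI / 2 * G x)) /\
  (forall x, is_RInt (fun t => G (x * sin t ^ 2)) 0 (PI / 2) (PI / 2 * F x)).
Proof.
induction 1 as [n f F Hf HF | c f F g G h H _ [f1 [IH1 IH1']] _ [g1 [IH2 IH2']] Hh HH].
- exists (fun x => cbin n * x ^ n); split; intros x.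
  + eapply is_RInt_ext; [|eapply is_RInt_eq; [apply (is_RInt_scalR (fun t => _) (x ^ n) _ _ _ (is_RInt_wallis n))|]].
    * intros t _; toR; rewrite Hf, Rpow_mult_distr; reflexivity.
    * ring.
  + eapply is_RInt_ext; [|eapply is_RInt_eq; [apply (is_RInt_scalR (fun t => _) (cbin n * x ^ n) _ _ _ (is_RInt_wallis n))|]].
    * intros t _; toR; rewrite Rpow_mult_distr; ring.
    * rewrite HF; ring.
- exists (fun x => c * f1 x + g1 x); split; intros x.
  + eapply is_RInt_ext; [|eapply is_RInt_eq; [apply is_RInt_lin; [apply IH1 | apply IH2]|]];
      [intros t _; toR; symmetry; apply Hh | ring].
  + eapply is_RInt_ext; [|eapply is_RInt_eq; [apply is_RInt_lin; [apply IH1' | apply IH2']|]];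
      [intros t _; toR; reflexivity | rewrite HH; ring].
Qed.

Lemma wallis_mean_close (f g : R -> R) (If Ig e : R) :
  is_RInt f 0 (PI / 2) (PI / 2 * If) -> is_RInt g 0 (PI / 2) (PI / 2 * Ig) ->
  (forall t, Rabs (f t - g t) <= e) -> Rabs (If - Ig) <= e.
Proof.
intros Hf Hg H; assert (Hpi := PI2_pos).
assert (D := is_RInt_dist f g 0 (PI / 2) _ _ e ltac:(lra) Hf Hg (fun t _ => H t)).
rewrite <- Rmult_minus_distr_l, Rabs_mult, (Rabs_right (PI / 2)) in D by lra.
apply Rmult_le_reg_l with (PI / 2); lra.
Qed.

(** F x and G y are the means of f (x s) and g (y s) for the same law of s on [0, 1], so
    uniform closeness is inherited. *)
Lemma arcsine_pair_close f F g G x y e :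
  arcsine_pair f F -> arcsine_pair g G ->
  (forall s, 0 <= s <= 1 -> Rabs (f (x * s) - g (y * s)) <= e) -> Rabs (F x - G y) <= e.
Proof.
intros Hf Hg H.
destruct (arcsine_pair_int f F Hf) as [f1 [Hf1 Hf2]].
destruct (arcsine_pair_int g G Hg) as [g1 [Hg1 Hg2]].
apply (wallis_mean_close _ _ _ _ _ (Hf2 x) (Hg2 y)); intros t.
apply (wallis_mean_close _ _ _ _ _ (Hf1 _) (Hg1 _)); intros t'.
rewrite !Rmult_assoc; apply H.
assert (A := sin2_range t); assert (B := sin2_range t'); nra.
Qed.

(** By partial fractions the moment (n+1) / (2 (n+1/2)^2 (n+3/2)) is half the integral
    of (1 - y^2) y^(2n) plus 1 / (2n+1)^2, and the latter is the mean over u of the mean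
    over t of (u t)^(2n). Both functionals make sense for any continuous f, polynomial or
    not. *)
Lemma arcsine_pair_moment f F : arcsine_pair f F -> exists (a : R -> R) (v w : R),
  is_RInt (fun y => (1 - y ^ 2) * f (y ^ 2)) 0 1 v /\
  (forall u, is_RInt (fun t => f (u ^ 2 * t ^ 2)) 0 1 (a u)) /\
  is_RInt a 0 1 w /\
  is_RInt (fun x => F x * ellE (1 - x)) 0 1 (v / 2 + w).
Proof.
assert (P : forall n, is_RInt (fun t => t ^ n) 0 1 (/ (INR n + 1))).
{ intros n; assert (Hn := pos_INR n).
  eapply is_RInt_eq; [apply (is_RInt_derive (fun t => t ^ S n / (INR n + 1)))|].
  - intros t _; auto_derive; [exact I|].
    change (match n with O => 1 | S _ => INR n + 1 end) with (INR (S n)); rewrite S_INR; field; lra.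
  - intros t _; apply (ex_derive_continuous (V := R_NormedModule)); auto_derive; exact I.
  - rewrite pow1, pow_i by lia; unfold minus, plus, opp; simpl; field; lra. }
induction 1 as [n f F Hf HF | c f F g G h H _ [a1 [v1 [w1 [A1 [B1 [C1 D1]]]]]] _ [a2 [v2 [w2 [A2 [B2 [C2 D2]]]]]] Hh HH].
- assert (Hn := pos_INR n).
  exists (fun u => u ^ (2 * n) / (2 * INR n + 1)), (/ (2 * INR n + 1) - / (2 * INR n + 3)), (/ (2 * INR n + 1) ^ 2).
  assert (P2 := P (2 * n)%nat); rewrite mult_INR in P2; simpl (INR 2) in P2.
  repeat split.
  + assert (P3 := P (2 * n + 2)%nat); rewrite plus_INR, mult_INR in P3; simpl (INR 2) in P3.
    eapply is_RInt_ext; [|eapply is_RInt_eq; [apply (is_RInt_lin _ _ (-1) _ _ _ _ P3 P2)|]].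
    * intros y _; toR; rewrite Hf, <- pow_mult, pow_add; ring.
    * field; lra.
  + intros u.
    eapply is_RInt_ext; [|eapply is_RInt_eq; [apply (is_RInt_scalR (fun t => _) (u ^ (2 * n)) _ _ _ P2)|]].
    * intros t _; toR; rewrite Hf, Rpow_mult_distr, <- !pow_mult; reflexivity.
    * field; lra.
  + eapply is_RInt_ext; [|eapply is_RInt_eq; [apply (is_RInt_scalR (fun t => _) (/ (2 * INR n + 1)) _ _ _ P2)|]].
    * intros t _; toR; unfold Rdiv; ring.
    * field; lra.
  + eapply is_RInt_ext; [|eapply is_RInt_eq; [apply is_RInt_moment|]].
    * intros x _; toR; rewrite HF; reflexivity.
    * field; lra.
- exists (fun u => c * a1 u + a2 u), (c * v1 + v2), (c * w1 + w2); repeat split.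
  + eapply is_RInt_ext; [|apply (is_RInt_lin _ _ c _ _ _ _ A1 A2)]; intros y _; toR; rewrite Hh; ring.
  + intros u; eapply is_RInt_ext; [|apply (is_RInt_lin _ _ c _ _ _ _ (B1 u) (B2 u))]; intros y _; toR; rewrite Hh; ring.
  + apply is_RInt_lin; assumption.
  + eapply is_RInt_ext; [|eapply is_RInt_eq; [apply (is_RInt_lin _ _ c _ _ _ _ D1 D2)|]];
      [intros y _; toR; rewrite HH; ring | field].
Qed.

(** * The algebraic kernel and its double average *)

(** Inverse of p -> 4 p / (1 + p)^2, from (- infinity, 1) onto (-1, 1). *)
Definition disc_param (z : R) : R := (1 - sqrt (1 - z)) / (1 + sqrt (1 - z)).

(** Mean of [kernel (z * t ^ 2)] over t in [0, 1]; also sqrt (1 + p) for p the parameter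
    of z. *)
Definition kernel_mean (z : R) : R := sqrt (2 / (1 + sqrt (1 - z))).

(** The mean of [kernel (z * s)] for s distributed as the product of two independent
    arcsine variables, that is 3F2(1/4, 1/2, 3/4; 1, 1; z) continued to z < 1. Whipple's
    quadratic transformation expresses it through the cubes of the [cbin n]. *)
Definition kernel_transform (z : R) : R := kernel_mean z * PSeries cube_coef (- disc_param z).

Lemma disc_param_bound z : z < 1 -> Rabs (disc_param z) < 1.
Proof.
intros Hz; unfold disc_param; assert (Hu : 0 < sqrt (1 - z)) by (apply sqrt_lt_R0; lra).
set (u := sqrt (1 - z)) in *.
assert (E1 : 1 - (1 - u) / (1 + u) = 2 * u / (1 + u)) by (field; lra).
assert (E2 : 1 + (1 - u) / (1 + u) = 2 / (1 + u)) by (field; lra).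
assert (0 < 2 * u / (1 + u)) by (apply Rdiv_lt_0_compat; lra).
assert (0 < 2 / (1 + u)) by (apply Rdiv_lt_0_compat; lra).
apply Rabs_def1; lra.
Qed.

Lemma disc_param_1p z : 1 + disc_param z = 2 / (1 + sqrt (1 - z)).
Proof. unfold disc_param; assert (Hu := sqrt_pos (1 - z)); field; lra. Qed.

Lemma disc_param_inv z : z < 1 -> 4 * disc_param z / (1 + disc_param z) ^ 2 = z.
Proof.
intros Hz; rewrite disc_param_1p; unfold disc_param; assert (Hu := sqrt_pos (1 - z)).
assert (Hs : sqrt (1 - z) * sqrt (1 - z) = 1 - z) by (apply sqrt_sqrt; lra).
set (u := sqrt (1 - z)) in *.
transitivity (1 - u * u); [field; lra | lra].
Qed.

Lemma kernel_mean_bound z : 0 < kernel_mean z <= sqrt 2.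
Proof.
unfold kernel_mean; assert (Hu := sqrt_pos (1 - z)); split.
- apply sqrt_lt_R0, Rdiv_lt_0_compat; lra.
- apply sqrt_le_1_alt, Rmult_le_reg_r with (1 + sqrt (1 - z)); [lra|].
  unfold Rdiv; rewrite Rmult_assoc, Rinv_l; lra.
Qed.

Lemma sqrt2_lt : sqrt 2 < 3 / 2.
Proof. rewrite <- (sqrt_pow2 (3 / 2)) by lra; apply sqrt_lt_1_alt; lra. Qed.

Lemma kernel_mean_sqr z : kernel_mean z ^ 2 = 2 / (1 + sqrt (1 - z)).
Proof.
unfold kernel_mean; rewrite pow2_sqrt; [reflexivity|].
assert (Hu := sqrt_pos (1 - z)); apply Rlt_le, Rdiv_lt_0_compat; lra.
Qed.

(** Partial sums of the Legendre generating series at the parameter of z. They converge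
    uniformly in q since the Legendre polynomials are bounded by 1, and the Saalschuetz sum
    evaluates their double means. *)
Lemma kernel_approx z eps : z < 1 -> 0 < eps -> exists f F, arcsine_pair f F /\
  (forall q, 0 <= q <= 1 -> Rabs (f q - kernel (z * q)) <= eps) /\
  Rabs (F 1 - kernel_transform z) <= eps.
Proof.
intros Hz He; assert (Hp := disc_param_bound z Hz); assert (Hp' := Rabs_def2 _ _ Hp).
assert (Ea : sqrt (1 + disc_param z) = kernel_mean z) by (rewrite disc_param_1p; reflexivity).
assert (Ez := disc_param_inv z Hz).
assert (Ba := kernel_mean_bound z); assert (B2 := sqrt2_lt).
set (p := disc_param z) in *; set (a := kernel_mean z) in *.
assert (Hp0 := Rabs_pos p).
destruct (geom_small (Rabs p) (eps / 2)) as [N HN]; [lra | lra |].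
specialize (HN N (le_n _)).
assert (T : forall (b : nat -> R) (x : R), (forall n, Rabs (b n) <= 1) -> Rabs x = Rabs p ->
  Rabs (a * sum_f_R0 (fun k => b k * x ^ k) N - a * PSeries b x) <= eps).
{ intros b x Hb Hx; rewrite <- Rmult_minus_distr_l, Rabs_mult, (Rabs_right a) by lra.
  rewrite Rabs_minus_sym.
  assert (Ht := PSeries_tail b x (Rabs p) N Hb ltac:(lra)).
  apply Rle_trans with (2 * (eps / 2)); [|lra].
  apply Rmult_le_compat; try lra; apply Rabs_pos. }
set (L := fun k q => sum_f_R0 (fun j => leg_even_coef k j * q ^ j) k).
set (M := fun k q => sum_f_R0 (fun j => leg_even_coef k j * (cbin j ^ 2 * q ^ j)) k).
assert (HLM : forall k, arcsine_pair (L k) (M k)).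
{ intros k; apply (arcsine_sum (leg_even_coef k) (fun j x => x ^ j) (fun j x => cbin j ^ 2 * x ^ j)).
  intros j; apply (arcsine_mono j); reflexivity. }
exists (fun q => a * sum_f_R0 (fun k => p ^ k * L k q) N).
exists (fun q => a * sum_f_R0 (fun k => p ^ k * M k q) N).
split; [apply arcsine_scal, (arcsine_sum (fun k => p ^ k) L M N HLM)|]; split.
- intros q Hq.
  assert (Hs : -1 <= sqrt q <= 1).
  { assert (H0 := sqrt_pos q); split; [lra|]; rewrite <- sqrt_1; apply sqrt_le_1_alt; lra. }
  assert (Hss : sqrt q ^ 2 = q) by (apply pow2_sqrt; lra).
  assert (G := gen_even_closed (sqrt q) p Hs Hp).
  rewrite Hss, Ea in G.
  replace (4 * p * q / (1 + p) ^ 2) with (z * q) in G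
    by (rewrite <- Ez at 1; field; lra).
  rewrite <- G.
  rewrite (sum_eq (fun k => p ^ k * L k q) (fun k => leg_even (sqrt q) k * p ^ k)).
  + apply T; [apply Rabs_leg_even, Hs | reflexivity].
  + intros k _; rewrite (proj1 (legendre_coef _ k)), Hss; apply Rmult_comm.
- (* the sign (-1)^k of the Saalschuetz sum turns p into - p *)
  rewrite (sum_eq (fun k => p ^ k * M k 1) (fun k => cube_coef k * (- p) ^ k)).
  + apply T; [apply Rabs_cube_coef | apply Rabs_Ropp].
  + intros k _.
    transitivity (p ^ k * ((-1) ^ k * cbin k ^ 3)).
    * f_equal; rewrite <- saalschuetz; apply sum_eq; intros j _; rewrite pow1; ring.
    * replace (- p) with (-1 * p) by ring; rewrite Rpow_mult_distr; unfold cube_coef; ring.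
Qed.

(** For fixed x, the function s -> f (x s) and the Legendre approximation belonging to z
    = c x are close to the same function, the kernel on the segment from 0 to c x; hence so
    are their double means. *)
Lemma arcsine_pair_kernel c f F e : c < 1 -> arcsine_pair f F ->
  (forall q, 0 <= q <= 1 -> Rabs (f q - kernel (c * q)) <= e) ->
  forall x, 0 <= x <= 1 -> Rabs (F x - kernel_transform (c * x)) <= e.
Proof.
intros Hc HfF Hf x Hx.
assert (Hcx : c * x < 1) by (destruct (Rle_dec c 0); nra).
apply le_epsilon; intros d Hd.
destruct (kernel_approx (c * x) (d / 2) Hcx ltac:(lra)) as [g [G [HgG [Hg HG]]]].
assert (H : Rabs (F x - G 1) <= e + d / 2).
{ apply (arcsine_pair_close f F g G x 1 _ HfF HgG); intros s Hs.
  assert (H1 := Hf (x * s) ltac:(nra)); assert (H2 := Hg s Hs).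
  rewrite Rmult_1_l; rewrite Rabs_minus_sym in H2; rewrite <- Rmult_assoc in H1.
  replace (f (x * s) - g s) with ((f (x * s) - kernel (c * x * s)) + (kernel (c * x * s) - g s)) by ring.
  eapply Rle_trans; [apply Rabs_triang | lra]. }
replace (F x - kernel_transform (c * x)) with ((F x - G 1) + (G 1 - kernel_transform (c * x))) by ring.
eapply Rle_trans; [apply Rabs_triang | lra].
Qed.

(** * Integrals of the kernel *)

Lemma kernel_eq z : z < 1 -> kernel z = kernel_mean z * (1 + sqrt (1 - z)) / (2 * sqrt (1 - z)).
Proof.
intros Hz; assert (Hu : 0 < sqrt (1 - z)) by (apply sqrt_lt_R0; lra).
assert (Hs : sqrt (1 - z) * sqrt (1 - z) = 1 - z) by (apply sqrt_sqrt; lra).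
assert (Ha := kernel_mean_bound z); assert (Ha2 := kernel_mean_sqr z).
unfold kernel; set (u := sqrt (1 - z)) in *; set (a := kernel_mean z) in *.
apply sqrt_lem_1.
- apply Rlt_le, Rdiv_lt_0_compat; lra.
- apply Rlt_le, Rdiv_lt_0_compat; [apply Rmult_lt_0_compat; lra | lra].
- transitivity (a ^ 2 * (1 + u) ^ 2 / (4 * (u * u))); [field; lra|].
  rewrite Ha2, Hs; field; lra.
Qed.

(** With T = t a, a the value of [kernel_mean], this says that the substitution T
    absorbs the kernel: dT = kernel dt. *)
Lemma is_derive_kernel_mean z t : z * t ^ 2 < 1 ->
  is_derive (fun t => t * kernel_mean (z * t ^ 2)) t (kernel (z * t ^ 2)).
Proof.
intros Hz; assert (Hu : 0 < sqrt (1 - z * t ^ 2)) by (apply sqrt_lt_R0; lra).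
assert (Hs : sqrt (1 - z * t ^ 2) * sqrt (1 - z * t ^ 2) = 1 - z * t ^ 2) by (apply sqrt_sqrt; lra).
rewrite kernel_eq by exact Hz.
assert (Ha := kernel_mean_bound (z * t ^ 2)); assert (Ha2 := kernel_mean_sqr (z * t ^ 2)).
evar_last.
- unfold kernel_mean; auto_derive; [|reflexivity].
  change (1 + - (z * (t * (t * 1)))) with (1 - z * t ^ 2).
  repeat split; try lra.
  apply Rdiv_lt_0_compat; lra.
- change (1 + - (z * (t * (t * 1)))) with (1 - z * t ^ 2).
  change (2 * / (1 + sqrt (1 - z * t ^ 2))) with (2 / (1 + sqrt (1 - z * t ^ 2))).
  fold (kernel_mean (z * t ^ 2)).
  set (a := kernel_mean (z * t ^ 2)) in *; set (u := sqrt (1 - z * t ^ 2)) in *.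
  assert (Ez : z * (t * t) = 1 - u * u) by (rewrite Hs; ring).
  apply Rmult_eq_reg_l with (2 * a * u * (1 + u) ^ 2); [|apply Rgt_not_eq; repeat apply Rmult_lt_0_compat; nra].
  transitivity (2 * u * (1 + u) ^ 2 * a ^ 2 + 2 * (z * (t * t))); [field; lra|].
  transitivity (a ^ 2 * (1 + u) ^ 3); [|field; lra].
  rewrite Ez, Ha2; field; lra.
Qed.

Lemma continuous_kernel z : z < 1 -> continuous kernel z.
Proof.
intros Hz; apply (ex_derive_continuous (V := R_NormedModule)); unfold kernel; auto_derive.
assert (Hu := sqrt_lt_R0 (1 - z) ltac:(lra)).
change (1 + - z) with (1 - z).
repeat split; try lra.
apply Rdiv_lt_0_compat; lra.
Qed.

Lemma continuous_kernel_mean z : continuous kernel_mean z.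
Proof.
unfold kernel_mean; apply continuous_sqrt_comp.
apply (continuous_mult (fun _ => 2) (fun z => / (1 + sqrt (1 - z)))); [apply continuous_const|].
apply (continuous_comp (fun z => 1 + sqrt (1 - z)) Rinv).
- apply (continuous_plus (fun _ => 1) (fun z => sqrt (1 - z))); [apply continuous_const|].
  apply continuous_sqrt_comp, (continuous_minus (fun _ => 1) (fun z => z));
    [apply continuous_const | apply continuous_id].
- apply continuous_Rinv; assert (H := sqrt_pos (1 - z)); lra.
Qed.

Lemma mul_sqr_lt1 c y : c < 1 -> 0 <= y <= 1 -> c * y ^ 2 < 1.
Proof. intros Hc Hy; assert (0 <= y ^ 2 <= 1) by nra; destruct (Rle_dec c 0); nra. Qed.

Ltac on01 := intros ? Hy01; rewrite Rmin_left, Rmax_right in Hy01 by lra.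

Lemma continuous_kernel_sqr c y : c < 1 -> 0 <= y <= 1 ->
  continuous (fun t => kernel (c * t ^ 2)) y.
Proof.
intros Hc Hy; apply (continuous_comp (fun t => c * t ^ 2) kernel).
- apply (ex_derive_continuous (V := R_NormedModule)); auto_derive; exact I.
- apply continuous_kernel, mul_sqr_lt1; assumption.
Qed.

Lemma is_RInt_kernel z : z < 1 -> is_RInt (fun t => kernel (z * t ^ 2)) 0 1 (kernel_mean z).
Proof.
intros Hz; eapply is_RInt_eq; [apply (is_RInt_derive (fun t => t * kernel_mean (z * t ^ 2)))|].
- on01; apply is_derive_kernel_mean, mul_sqr_lt1; assumption.
- on01; apply continuous_kernel_sqr; assumption.
- unfold minus, plus, opp; simpl; rewrite !Rmult_1_r; ring.
Qed.

(** In terms of T = y a one has kernel dy = dT and y^2 = T^2 - c T^4 / 4, so the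
    integrand becomes polynomial. *)
Lemma is_RInt_kernel_weight c : c < 1 ->
  is_RInt (fun y => (1 - y ^ 2) * kernel (c * y ^ 2)) 0 1
    (kernel_mean c - kernel_mean c ^ 3 / 3 + c * kernel_mean c ^ 5 / 20).
Proof.
intros Hc.
set (T := fun y => y * kernel_mean (c * y ^ 2)).
eapply is_RInt_eq; [apply (is_RInt_derive (fun y => T y - T y ^ 3 / 3 + c * T y ^ 5 / 20))|].
- intros y Hy; rewrite Rmin_left, Rmax_right in Hy by lra.
  assert (Hz := mul_sqr_lt1 c y Hc Hy).
  assert (D : is_derive T y (kernel (c * y ^ 2))) by (apply is_derive_kernel_mean, Hz).
  assert (DT : Derive (fun y => T y) y = _) by exact (is_derive_unique _ _ _ D).
  assert (ET : T y ^ 2 = y ^ 2 * (2 / (1 + sqrt (1 - c * y ^ 2))))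
    by (unfold T; rewrite Rpow_mult_distr, kernel_mean_sqr; reflexivity).
  assert (Hu := sqrt_pos (1 - c * y ^ 2)).
  assert (Hs : sqrt (1 - c * y ^ 2) * sqrt (1 - c * y ^ 2) = 1 - c * y ^ 2) by (apply sqrt_sqrt; lra).
  set (u := sqrt (1 - c * y ^ 2)) in *.
  clearbody T; auto_derive; [repeat split; auto; eexists; eassumption|].
  rewrite DT.
  transitivity ((1 - T y ^ 2 + c * (T y ^ 2) ^ 2 / 4) * kernel (c * y ^ 2)); [field|].
  f_equal; rewrite ET.
  transitivity (1 - y ^ 2 * (2 * (1 + u) - c * y ^ 2) / (1 + u) ^ 2); [field; lra|].
  replace (c * y ^ 2) with (1 - u * u) by lra; field; lra.
- on01; apply (continuous_mult (fun y => 1 - y ^ 2) (fun y => kernel (c * y ^ 2))).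
  + apply (ex_derive_continuous (V := R_NormedModule)); auto_derive; exact I.
  + apply continuous_kernel_sqr; assumption.
- unfold T, minus, plus, opp; simpl; rewrite !Rmult_1_r; field.
Qed.

(** In terms of T = y a one has a dy = (2 - 1 / (1 - c T^2 / 4)) dT. The primitive [L]
    is an arctangent or a logarithm according to the sign of c. *)
Lemma is_RInt_kernel_mean c (L : R -> R) : c < 1 -> L 0 = 0 ->
  (forall b, c * b ^ 2 < 4 -> is_derive L b (/ (1 - c * b ^ 2 / 4))) ->
  is_RInt (fun y => kernel_mean (c * y ^ 2)) 0 1 (2 * kernel_mean c - L (kernel_mean c)).
Proof.
intros Hc HL0 HL.
set (T := fun y => y * kernel_mean (c * y ^ 2)).
eapply is_RInt_eq; [apply (is_RInt_derive (fun y => 2 * T y - L (T y)))|].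
- intros y Hy; rewrite Rmin_left, Rmax_right in Hy by lra.
  assert (Hz := mul_sqr_lt1 c y Hc Hy).
  assert (D : is_derive T y (kernel (c * y ^ 2))) by (apply is_derive_kernel_mean, Hz).
  assert (ET : T y ^ 2 = y ^ 2 * (2 / (1 + sqrt (1 - c * y ^ 2))))
    by (unfold T; rewrite Rpow_mult_distr, kernel_mean_sqr; reflexivity).
  assert (Hu : 0 < sqrt (1 - c * y ^ 2)) by (apply sqrt_lt_R0; lra).
  assert (Hs : sqrt (1 - c * y ^ 2) * sqrt (1 - c * y ^ 2) = 1 - c * y ^ 2) by (apply sqrt_sqrt; lra).
  assert (EcT : c * T y ^ 2 = 2 * (1 - sqrt (1 - c * y ^ 2))).
  { rewrite ET; transitivity (c * y ^ 2 * 2 / (1 + sqrt (1 - c * y ^ 2))); [field; lra|].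
    replace (c * y ^ 2 * 2) with ((1 - sqrt (1 - c * y ^ 2) * sqrt (1 - c * y ^ 2)) * 2) by (rewrite Hs; ring).
    field; lra. }
  assert (DL := HL (T y) ltac:(lra)).
  evar_last.
  + apply (is_derive_minus (fun y => 2 * T y) (fun y => L (T y))).
    * apply (is_derive_scal T), D.
    * apply (is_derive_comp L T); [exact DL | exact D].
  + change (2 * kernel (c * y ^ 2) + - (kernel (c * y ^ 2) * / (1 - c * T y ^ 2 / 4)) = kernel_mean (c * y ^ 2)).
    rewrite EcT, kernel_eq by exact Hz; field; lra.
- on01; apply (continuous_comp (fun y => c * y ^ 2) kernel_mean); [|apply continuous_kernel_mean].
  apply (ex_derive_continuous (V := R_NormedModule)); auto_derive; exact I.
- unfold T, minus, plus, opp; simpl; rewrite !Rmult_1_r, !Rmult_1_l, Rmult_0_l, HL0; ring.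
Qed.

Lemma continuous_kernel_transform z : z < 1 -> continuous kernel_transform z.
Proof.
intros Hz; apply (continuous_mult kernel_mean (fun z => PSeries cube_coef (- disc_param z))); [apply continuous_kernel_mean|].
apply (continuous_comp (fun z => - disc_param z) (PSeries cube_coef)).
- apply (ex_derive_continuous (V := R_NormedModule)); unfold disc_param; auto_derive.
  assert (Hu := sqrt_pos (1 - z)); change (1 + - z) with (1 - z); repeat split; lra.
- apply continuous_PSeries; [apply Rabs_cube_coef | rewrite Rabs_Ropp; apply disc_param_bound, Hz].
Qed.

(** * The integral of E K^2 for c < 1 *)

(** The moment identity holds for polynomials close to the kernel on the segment from 0
    to c; every term of it is continuous for the uniform norm, so it passes to the kernel
    itself. *)
Lemma is_RInt_kernel_transform c (L : R -> R) : c < 1 -> L 0 = 0 ->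
  (forall b, c * b ^ 2 < 4 -> is_derive L b (/ (1 - c * b ^ 2 / 4))) ->
  is_RInt (fun x => kernel_transform (c * x) * ellE (1 - x)) 0 1
    ((kernel_mean c - kernel_mean c ^ 3 / 3 + c * kernel_mean c ^ 5 / 20) / 2 + (2 * kernel_mean c - L (kernel_mean c))).
Proof.
intros Hc HL0 HL; assert (Hpi := PI2_pos).
assert (Hv := is_RInt_kernel_weight c Hc); assert (Hw := is_RInt_kernel_mean c L Hc HL0 HL).
set (v := kernel_mean c - kernel_mean c ^ 3 / 3 + c * kernel_mean c ^ 5 / 20) in *.
set (w := 2 * kernel_mean c - L (kernel_mean c)) in *.
assert (HI : is_RInt (fun x => kernel_transform (c * x) * ellE (1 - x)) 0 1
               (RInt (fun x => kernel_transform (c * x) * ellE (1 - x)) 0 1)).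
{ apply is_RInt_RInt, ex_RInt_cont; on01.
  apply (continuous_mult (fun x => kernel_transform (c * x)) (fun x => ellE (1 - x))); [|apply continuous_ellE_compl].
  apply (continuous_comp (fun x => c * x) kernel_transform).
  - apply (ex_derive_continuous (V := R_NormedModule)); auto_derive; exact I.
  - apply continuous_kernel_transform; destruct (Rle_dec c 0); nra. }
eapply is_RInt_eq; [exact HI|].
set (J := RInt (fun x => kernel_transform (c * x) * ellE (1 - x)) 0 1) in *.
apply (eq_of_close _ _ (PI / 2 + 1 / 2 + 1)); [lra|]; intros e He.
destruct (kernel_approx c e Hc He) as [f [F [HfF [Hf _]]]].
assert (HF := arcsine_pair_kernel c f F e Hc HfF Hf).
destruct (arcsine_pair_moment f F HfF) as [a [v' [w' [Hv' [Ha [Hw' HJ']]]]]].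
assert (D1 : Rabs (v' - v) <= (1 - 0) * e).
{ refine (is_RInt_dist _ _ 0 1 _ _ e ltac:(lra) Hv' Hv _); intros y Hy.
  rewrite <- Rmult_minus_distr_l, Rabs_mult, <- (Rmult_1_l e).
  apply Rmult_le_compat; try apply Rabs_pos.
  - apply Rabs_le; nra.
  - apply Hf; nra. }
assert (D2 : Rabs (w' - w) <= (1 - 0) * e).
{ refine (is_RInt_dist _ _ 0 1 _ _ e ltac:(lra) Hw' Hw _); intros u Hu.
  assert (Hcu := mul_sqr_lt1 c u Hc Hu).
  replace e with ((1 - 0) * e) by ring.
  refine (is_RInt_dist _ _ 0 1 _ _ e ltac:(lra) (Ha u) (is_RInt_kernel _ Hcu) _); intros t Ht.
  rewrite Rmult_assoc; apply Hf.
  assert (0 <= u ^ 2 <= 1) by nra; assert (0 <= t ^ 2 <= 1) by nra; nra. }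
assert (D3 : Rabs (J - (v' / 2 + w')) <= (1 - 0) * (PI / 2 * e)).
{ refine (is_RInt_dist _ _ 0 1 _ _ _ ltac:(lra) HI HJ' _); intros x Hx.
  rewrite <- Rmult_minus_distr_r, Rabs_mult, Rmult_comm.
  assert (HE := ellE_bounds (1 - x) ltac:(lra)).
  apply Rmult_le_compat; try apply Rabs_pos.
  - rewrite Rabs_right; lra.
  - rewrite Rabs_minus_sym; apply HF, Hx. }
replace (J - (v / 2 + w)) with ((J - (v' / 2 + w')) + ((v' - v) / 2 + (w' - w))) by field.
eapply Rle_trans; [apply Rabs_triang|].
assert (D4 := Rabs_triang ((v' - v) / 2) (w' - w)).
unfold Rdiv in D4 at 2; rewrite Rabs_mult, (Rabs_right (/ 2)) in D4 by lra.
lra.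
Qed.

(** The shape common to the four integrands, at z = c x: there k^2 = (1 - a) / 2 with a
    = sqrt (2 / (1 + sqrt (1 - z))). *)
Definition weighted_K2 (z : R) : R := kernel_mean z * ellK ((1 - kernel_mean z) / 2) ^ 2.

Lemma weighted_K2_transform z : z < 1 -> weighted_K2 z = (PI / 2) ^ 2 * kernel_transform z.
Proof.
intros Hz; unfold weighted_K2, kernel_transform.
assert (Ha := kernel_mean_bound z); assert (Ha2 := kernel_mean_sqr z).
assert (Hp := disc_param_1p z); assert (Hb := Rabs_def2 _ _ (disc_param_bound z Hz)).
assert (E : 4 * ((1 - kernel_mean z) / 2) * (1 - (1 - kernel_mean z) / 2) = - disc_param z).
{ transitivity (1 - kernel_mean z ^ 2); [field | lra]. }
rewrite ellK_clausen; rewrite ?E; [ring | lra | lra].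
Qed.

Lemma continuous_weighted_K2 z : continuous weighted_K2 z.
Proof.
assert (Ha := kernel_mean_bound z); assert (H2 := sqrt2_lt).
assert (C : continuous (fun z => ellK ((1 - kernel_mean z) / 2)) z).
{ apply (continuous_comp (fun z => (1 - kernel_mean z) / 2) ellK).
  - apply (continuous_mult (fun z => 1 - kernel_mean z) (fun _ => / 2)); [|apply continuous_const].
    apply (continuous_minus (fun _ => 1) kernel_mean); [apply continuous_const | apply continuous_kernel_mean].
  - apply (ex_derive_continuous ellK); eexists; apply is_derive_ellK, Rabs_def1; lra. }
apply (continuous_mult kernel_mean (fun z => ellK ((1 - kernel_mean z) / 2) ^ 2)); [apply continuous_kernel_mean|].
apply (continuous_mult (fun z => ellK ((1 - kernel_mean z) / 2)) (fun z => ellK ((1 - kernel_mean z) / 2) * 1)); [exact C|].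
apply (continuous_mult (fun z => ellK ((1 - kernel_mean z) / 2)) (fun _ => 1)); [exact C | apply continuous_const].
Qed.

(** The argument [l] stands for the transcendental part, the value at [kernel_mean c] of
    a primitive of 1 / (1 - c b^2 / 4). *)
Definition moment_value (c l : R) : R :=
  (PI / 2) ^ 2 * ((kernel_mean c - kernel_mean c ^ 3 / 3 + c * kernel_mean c ^ 5 / 20) / 2 + (2 * kernel_mean c - l)).

Lemma is_RInt_weighted_K2 c (L : R -> R) : c < 1 -> L 0 = 0 ->
  (forall b, c * b ^ 2 < 4 -> is_derive L b (/ (1 - c * b ^ 2 / 4))) ->
  is_RInt (fun x => ellE (1 - x) * weighted_K2 (c * x)) 0 1 (moment_value c (L (kernel_mean c))).
Proof.
intros Hc HL0 HL.
eapply is_RInt_ext; [|apply (is_RInt_scalR _ ((PI / 2) ^ 2) _ _ _ (is_RInt_kernel_transform c L Hc HL0 HL))].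
intros x Hx; rewrite Rmin_left, Rmax_right in Hx by lra; toR.
rewrite weighted_K2_transform by (destruct (Rle_dec c 0); nra); ring.
Qed.

(** * The integral of E K^2 for c = 1 and for negative c *)

(** For c > 0 the primitive of 1 / (1 - c b^2 / 4) is a logarithm; this is its value at
    [kernel_mean c]. *)
Definition log_term (c : R) : R :=
  ln ((1 + sqrt c * kernel_mean c / 2) / (1 - sqrt c * kernel_mean c / 2)) / sqrt c.

Lemma kernel_mean_1 : kernel_mean 1 = sqrt 2.
Proof. unfold kernel_mean; rewrite Rminus_diag, sqrt_0; f_equal; field. Qed.

Lemma is_RInt_weighted_K2_pos c : 0 < c < 1 ->
  is_RInt (fun x => ellE (1 - x) * weighted_K2 (c * x)) 0 1 (moment_value c (log_term c)).
Proof.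
intros Hc; assert (Hk := sqrt_lt_R0 c (proj1 Hc)); assert (Hk2 := sqrt_sqrt c ltac:(lra)).
set (k := sqrt c) in *.
apply (is_RInt_weighted_K2 c (fun b => ln ((1 + k * b / 2) / (1 - k * b / 2)) / k)); [lra | |].
- replace ((1 + k * 0 / 2) / (1 - k * 0 / 2)) with 1 by field.
  rewrite ln_1; unfold Rdiv; ring.
- intros b Hb.
  assert (Hkb : -1 < k * b / 2 < 1) by (assert ((k * b) ^ 2 < 4) by nra; split; nra).
  auto_derive.
  + change (1 + - (k * b / 2)) with (1 - k * b / 2).
    assert (0 < (1 + k * b / 2) / (1 - k * b / 2)) by (apply Rdiv_lt_0_compat; lra).
    unfold Rdiv in *; repeat split; [lra | exact H].
  + rewrite <- Hk2; change (1 + - (k * b / 2)) with (1 - k * b / 2).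
    assert (k * k * b ^ 2 < 4) by (rewrite Hk2; exact Hb).
    field; repeat split; try lra; nra.
Qed.

Lemma continuous_log_term_1 : continuous log_term 1.
Proof.
assert (C : continuous (fun c => sqrt c * kernel_mean c / 2) 1).
{ apply (continuous_mult (fun c => sqrt c * kernel_mean c) (fun _ => / 2)); [|apply continuous_const].
  apply (continuous_mult sqrt kernel_mean); [apply continuous_sqrt | apply continuous_kernel_mean]. }
assert (E : sqrt 1 * kernel_mean 1 / 2 = sqrt 2 / 2) by (rewrite kernel_mean_1, sqrt_1; field).
assert (B := sqrt2_lt); assert (B0 := sqrt_lt_R0 2 ltac:(lra)).
apply (continuous_mult (fun c => ln ((1 + sqrt c * kernel_mean c / 2) / (1 - sqrt c * kernel_mean c / 2))) (fun c => / sqrt c)).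
- apply (continuous_comp (fun c => (1 + sqrt c * kernel_mean c / 2) / (1 - sqrt c * kernel_mean c / 2)) ln).
  + apply (continuous_mult (fun c => 1 + sqrt c * kernel_mean c / 2) (fun c => / (1 - sqrt c * kernel_mean c / 2))).
    * apply (continuous_plus (fun _ => 1) (fun c => sqrt c * kernel_mean c / 2)); [apply continuous_const | exact C].
    * apply (continuous_comp (fun c => 1 - sqrt c * kernel_mean c / 2) Rinv).
      -- apply (continuous_minus (fun _ => 1) (fun c => sqrt c * kernel_mean c / 2)); [apply continuous_const | exact C].
      -- apply continuous_Rinv; lra.
  + rewrite E; apply (ex_derive_continuous (V := R_NormedModule)); auto_derive.
    apply Rdiv_lt_0_compat; lra.
- apply (continuous_comp sqrt Rinv); [apply continuous_sqrt|].
  apply continuous_Rinv; rewrite sqrt_1; lra.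
Qed.

Lemma log_term_1 : log_term 1 = 2 * ln (1 + sqrt 2).
Proof.
assert (B := sqrt2_lt); assert (B0 := sqrt_lt_R0 2 ltac:(lra)); assert (S := sqrt_sqrt 2 ltac:(lra)).
unfold log_term; rewrite kernel_mean_1, sqrt_1.
replace ((1 + 1 * sqrt 2 / 2) / (1 - 1 * sqrt 2 / 2)) with ((1 + sqrt 2) * (1 + sqrt 2)).
- rewrite ln_mult by lra; field.
- apply Rmult_eq_reg_r with (1 - 1 * sqrt 2 / 2); [|lra].
  transitivity (1 + 1 * sqrt 2 / 2); [|field; lra].
  set (r := sqrt 2) in *; replace ((1 + r) * (1 + r) * (1 - 1 * r / 2)) with
    (1 + 3 / 2 * r - (r * r) * r / 2) by field.
  rewrite S; field.
Qed.

Lemma continuous_moment_value_log : continuous (fun c => moment_value c (log_term c)) 1.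
Proof.
assert (P : forall (f g : R -> R), continuous f 1 -> continuous g 1 -> continuous (fun c => f c * g c) 1)
  by (intros f g Hf Hg; exact (continuous_mult f g 1 Hf Hg)).
assert (A := continuous_kernel_mean 1); assert (C := continuous_log_term_1).
assert (PW : forall n, continuous (fun c => kernel_mean c ^ n) 1).
{ induction n as [|n IH]; [apply continuous_const | apply (P kernel_mean (fun c => kernel_mean c ^ n) A IH)]. }
assert (K : forall r : R, continuous (fun _ : R => r) 1) by (intros; apply continuous_const).
unfold moment_value.
apply (P (fun _ => (PI / 2) ^ 2)); [apply K|].
apply (continuous_plus (fun c => (kernel_mean c - kernel_mean c ^ 3 / 3 + c * kernel_mean c ^ 5 / 20) / 2)
         (fun c => 2 * kernel_mean c - log_term c)).
- apply (P (fun c => kernel_mean c - kernel_mean c ^ 3 / 3 + c * kernel_mean c ^ 5 / 20) (fun _ => / 2)); [|apply K].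
  apply (continuous_plus (fun c => kernel_mean c - kernel_mean c ^ 3 / 3) (fun c => c * kernel_mean c ^ 5 / 20)).
  + apply (continuous_minus kernel_mean (fun c => kernel_mean c ^ 3 / 3)); [exact A|].
    apply (P (fun c => kernel_mean c ^ 3) (fun _ => / 3)); [apply PW | apply K].
  + apply (P (fun c => c * kernel_mean c ^ 5) (fun _ => / 20)); [|apply K].
    apply (P (fun c => c) (fun c => kernel_mean c ^ 5)); [apply continuous_id | apply PW].
- apply (continuous_minus (fun c => 2 * kernel_mean c) log_term); [|exact C].
  apply (P (fun _ => 2) kernel_mean); [apply K | exact A].
Qed.

(** At c = 1 the kernel is unbounded near the end of the interval. The value is the
    limit from c < 1, since [weighted_K2] is uniformly continuous on [0, 1]. *)
Lemma is_RInt_weighted_K2_1 :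
  is_RInt (fun x => ellE (1 - x) * weighted_K2 (1 * x)) 0 1 (moment_value 1 (2 * ln (1 + sqrt 2))).
Proof.
rewrite <- log_term_1; assert (Hpi := PI2_pos).
assert (HI : is_RInt (fun x => ellE (1 - x) * weighted_K2 (1 * x)) 0 1
               (RInt (fun x => ellE (1 - x) * weighted_K2 (1 * x)) 0 1)).
{ apply is_RInt_RInt, ex_RInt_cont; intros x _.
  apply (continuous_mult (fun x => ellE (1 - x)) (fun x => weighted_K2 (1 * x))); [apply continuous_ellE_compl|].
  apply (continuous_comp (fun x => 1 * x) weighted_K2); [|apply continuous_weighted_K2].
  apply (ex_derive_continuous (V := R_NormedModule)); auto_derive; exact I. }
eapply is_RInt_eq; [exact HI|].
apply (eq_of_close _ _ (PI / 2 + 1)); [lra|]; intros e He.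
destruct (unifcont_normed_1d (V := R_NormedModule) weighted_K2 0 1 (fun x _ => continuous_weighted_K2 x) (mkposreal e He)) as [d1 Hd1].
assert (CV := continuous_moment_value_log).
apply continuity_pt_filterlim in CV; destruct (CV e He) as [d2 [Hd2 HV]].
assert (Hd1' := cond_pos d1).
(* compare with the value at 1 - d, d small for both moduli of continuity *)
set (d := Rmin (Rmin d1 d2) 1 / 2).
assert (Hd : 0 < d < 1 /\ d < d1 /\ d < d2)
  by (unfold d, Rmin; repeat destruct Rle_dec; lra).
assert (Hc := is_RInt_weighted_K2_pos (1 - d) ltac:(lra)).
assert (D1 := is_RInt_dist _ _ 0 1 _ _ (PI / 2 * e) ltac:(lra) HI Hc).
assert (D2 : Rabs (moment_value (1 - d) (log_term (1 - d)) - moment_value 1 (log_term 1)) < e).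
{ apply HV; split; [split; [exact I | lra]|].
  simpl; unfold Rdist; rewrite Rabs_left; lra. }
replace (RInt (fun x => ellE (1 - x) * weighted_K2 (1 * x)) 0 1 - moment_value 1 (log_term 1)) with
  ((RInt (fun x => ellE (1 - x) * weighted_K2 (1 * x)) 0 1 - moment_value (1 - d) (log_term (1 - d)))
   + (moment_value (1 - d) (log_term (1 - d)) - moment_value 1 (log_term 1))) by ring.
eapply Rle_trans; [apply Rabs_triang|].
rewrite Rmult_plus_distr_r, Rmult_1_l; apply Rplus_le_compat; [|lra].
replace (PI / 2 * e) with ((1 - 0) * (PI / 2 * e)) by ring; apply D1; intros x Hx.
rewrite <- Rmult_minus_distr_l, Rabs_mult.
assert (HE := ellE_bounds (1 - x) ltac:(lra)).
apply Rmult_le_compat; try apply Rabs_pos; [rewrite Rabs_right; lra|].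
rewrite Rabs_minus_sym; apply Rlt_le.
apply (Hd1 (1 * x) ((1 - d) * x)); [lra | nra |].
apply (norm_compat1 (V := R_NormedModule)); unfold norm, minus, plus, opp; simpl; unfold abs; simpl.
replace ((1 - d) * x + - (1 * x)) with (- (d * x)) by ring.
rewrite Rabs_Ropp, Rabs_right; nra.
Qed.

Lemma is_RInt_weighted_K2_neg k : 0 < k ->
  is_RInt (fun x => ellE (1 - x) * weighted_K2 (- k ^ 2 * x)) 0 1
    (moment_value (- k ^ 2) (2 / k * atan (k * kernel_mean (- k ^ 2) / 2))).
Proof.
intros Hk; apply (is_RInt_weighted_K2 (- k ^ 2) (fun b => 2 / k * atan (k * b / 2))); [nra | |].
- replace (k * 0 / 2) with 0 by field; rewrite atan_0; ring.
- intros b _; auto_derive; [exact I|].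
  assert (0 <= (k * b) ^ 2) by apply pow2_ge_0; field; repeat split; nra.
Qed.

(** * From complex moduli to real parameters *)

Lemma is_RInt_RtoC (f : R -> R) (a b l : R) :
  is_RInt f a b l -> is_RInt (V := C_R_NormedModule) (fun x => RtoC (f x)) a b (RtoC l).
Proof.
intros H; apply (is_RInt_fct_extend_pair (U := R_NormedModule) (V := R_NormedModule)); [exact H|].
eapply is_RInt_eq; [apply (is_RInt_constR a b 0) | ring].
Qed.

Lemma RInt_RtoC (f : R -> R) (a b l : R) :
  is_RInt f a b l -> RInt (V := C_R_CompleteNormedModule) (fun x => RtoC (f x)) a b = RtoC l.
Proof. intros H; apply (is_RInt_unique (V := C_R_CompleteNormedModule)), is_RInt_RtoC, H. Qed.

Lemma modulus_arg (k : C) (m t : R) : (k ^ 2)%C = RtoC m ->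
  (1 - k ^ 2 * RtoC (sin t) ^ 2)%C = RtoC (1 - m * sin t ^ 2).
Proof. intros ->; rewrite RtoC_minus, RtoC_mult, RtoC_pow; reflexivity. Qed.

Lemma ellipK_real (k : C) (m : R) : m < 1 -> (k ^ 2)%C = RtoC m -> ellipK k = RtoC (ellK m).
Proof.
intros Hm Hk; unfold ellipK.
rewrite <- (RInt_RtoC _ _ _ _ (is_RInt_ellK m Hm)).
apply (RInt_ext (V := C_R_CompleteNormedModule)); intros t _.
assert (H := ellK_arg_pos m t Hm).
rewrite (modulus_arg k m t Hk), Csqrt_RtoC by lra.
symmetry; apply RtoC_inv, Rgt_not_eq, sqrt_lt_R0, H.
Qed.

Lemma ellipE_real (k : C) (m : R) : m <= 1 -> (k ^ 2)%C = RtoC m -> ellipE k = RtoC (ellE m).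
Proof.
intros Hm Hk; unfold ellipE.
rewrite <- (RInt_RtoC _ _ _ _ (is_RInt_ellE m)).
apply (RInt_ext (V := C_R_CompleteNormedModule)); intros t _.
assert (H := sin2_range t).
rewrite (modulus_arg k m t Hk), Csqrt_RtoC by (destruct (Rle_dec m 0); nra); reflexivity.
Qed.

Lemma root4_mult_sqr (d y : R) : 0 < d -> 0 < y -> root4 (d * y ^ 2) = root4 d * sqrt y.
Proof.
intros Hd Hy; unfold root4.
rewrite <- Rpower_mult_distr by (try apply pow_lt; assumption).
f_equal; rewrite <- Rpower_sqrt by assumption.
rewrite <- (Rpower_pow 2) by assumption; rewrite Rpower_mult; f_equal; simpl; field.
Qed.

Lemma root4_pos d : 0 < root4 d. Proof. apply exp_pos. Qed.

(** The base of the fourth root is d (1 + u)^2 with u = sqrt (1 - c x), and sqrt (1 + u)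
    is sqrt 2 divided by [kernel_mean (c * x)]. *)
Lemma is_RInt_elliptic (c d V : R) (k : R -> C) (W : R -> R) :
  is_RInt (fun x => ellE (1 - x) * weighted_K2 (c * x)) 0 1 V -> 0 < d ->
  (forall x, 0 < x < 1 -> (k x ^ 2)%C = RtoC ((1 - kernel_mean (c * x)) / 2)) ->
  (forall x, 0 < x < 1 -> W x = d * (1 + sqrt (1 - c * x)) ^ 2) ->
  is_RInt (V := C_R_NormedModule)
    (fun x => ellipE (RtoC (sqrt (1 - x))) * ellipK (k x) ^ 2 / RtoC (root4 (W x)))%C
    0 1 (RtoC (V / (sqrt 2 * root4 d))).
Proof.
intros HV Hd Hk HW; assert (Hr := root4_pos d); assert (H2 := sqrt_lt_R0 2 ltac:(lra)).
replace (V / (sqrt 2 * root4 d)) with (/ (sqrt 2 * root4 d) * V) by (unfold Rdiv; ring).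
refine (is_RInt_ext (V := C_R_NormedModule) _ _ _ _ _ _ (is_RInt_RtoC _ _ _ _ (is_RInt_scalR _ (/ (sqrt 2 * root4 d)) _ _ _ HV))).
intros x Hx; rewrite Rmin_left, Rmax_right in Hx by lra.
assert (Ha := kernel_mean_bound (c * x)); assert (Hu := sqrt_pos (1 - c * x)).
rewrite (ellipE_real _ (1 - x)), (ellipK_real _ ((1 - kernel_mean (c * x)) / 2)); [|lra | apply Hk, Hx | lra |].
2: { rewrite <- RtoC_pow, pow2_sqrt by lra; reflexivity. }
rewrite HW, root4_mult_sqr by lra.
assert (Hs := sqrt_lt_R0 (1 + sqrt (1 - c * x)) ltac:(lra)).
rewrite <- RtoC_pow, <- RtoC_mult, <- RtoC_div
  by (apply Rgt_not_eq, Rmult_lt_0_compat; assumption).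
f_equal; unfold weighted_K2.
set (u := sqrt (1 - c * x)) in *.
assert (Ea : kernel_mean (c * x) = sqrt 2 / sqrt (1 + u)) by (apply sqrt_div_alt; lra).
rewrite Ea at 1; field; repeat split; lra.
Qed.

Lemma sqrt_eq_kernel_mean (y A z : R) : 0 <= A -> y = A ^ 2 * (2 / (1 + sqrt (1 - z))) ->
  sqrt y = A * kernel_mean z.
Proof.
intros HA ->; assert (Ha := kernel_mean_bound z).
rewrite <- kernel_mean_sqr, <- Rpow_mult_distr; apply sqrt_pow2, Rmult_le_pos; lra.
Qed.

Lemma kernel_mean_neg_le1 z : z <= 0 -> kernel_mean z <= 1.
Proof.
intros Hz; unfold kernel_mean.
assert (Hu : sqrt 1 <= sqrt (1 - z)) by (apply sqrt_le_1_alt; lra).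
rewrite sqrt_1 in Hu; apply Rle_trans with (sqrt 1); [|rewrite sqrt_1; lra].
apply sqrt_le_1_alt, Rmult_le_reg_r with (1 + sqrt (1 - z)); [lra|].
unfold Rdiv; rewrite Rmult_assoc, Rinv_l; lra.
Qed.

Lemma RtoC_sqrt_sqr (y : R) : 0 <= y -> (RtoC (sqrt y) ^ 2)%C = RtoC y.
Proof. intros Hy; rewrite <- RtoC_pow, pow2_sqrt by exact Hy; reflexivity. Qed.

Lemma atan_eq (x y : R) : - PI / 2 < y < PI / 2 -> tan y = x -> atan x = y.
Proof. intros Hy <-; apply atan_tan; lra. Qed.

Lemma root4_2 : root4 2 ^ 2 = sqrt 2.
Proof.
unfold root4; rewrite <- Rpower_pow by apply exp_pos.
rewrite Rpower_mult, <- Rpower_sqrt by lra; f_equal; simpl; field.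
Qed.

Lemma root4_half : root4 (1 / 2) = / root4 2.
Proof.
unfold root4; rewrite <- Rpower_Ropp; unfold Rpower; rewrite ln_div, ln_1 by lra.
f_equal; ring.
Qed.

Theorem corollary2 :
  is_RInt (V := C_R_NormedModule)
    (fun x : R =>
       ellipE (RtoC (sqrt (1 - x)))
       * ellipK (Csqrt (RtoC (1 / 2 - 1 / sqrt 2 * sqrt ((1 - sqrt (1 - x)) / x)))) ^ 2
       / RtoC (root4 (2 * sqrt (1 - x) - x + 2)))%C
    0 1
    (RtoC (PI ^ 2 * (17 / 30 - ln (1 + sqrt 2) / (2 * sqrt 2))))
  /\
  is_RInt (V := C_R_NormedModule)
    (fun x : R =>
       ellipE (RtoC (sqrt (1 - x)))
       * ellipK (RtoC (1 / (2 * sqrt 2)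
                       * sqrt (4 - sqrt 6 * sqrt ((sqrt (16 * x + 9) - 3) / x)))) ^ 2
       / RtoC (root4 (8 * x + 3 * sqrt (16 * x + 9) + 9)))%C
    0 1
    (RtoC (1 / root4 2 * (47 * PI ^ 2 / 160 - PI ^ 3 / (16 * sqrt 3))))
  /\
  is_RInt (V := C_R_NormedModule)
    (fun x : R =>
       ellipE (RtoC (sqrt (1 - x)))
       * ellipK (RtoC (sqrt (1 / 2 - 1 / 4 * sqrt ((sqrt (8 * x + 1) - 1) / x)))) ^ 2
       / RtoC (root4 (4 * x + sqrt (8 * x + 1) + 1)))%C
    0 1
    (RtoC (1 / Rpower 2 (7 / 4) * (71 * PI ^ 2 / 60 - PI ^ 3 / 8)))
  /\
  is_RInt (V := C_R_NormedModule)
    (fun x : R =>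
       ellipE (RtoC (sqrt (1 - x)))
       * ellipK (RtoC (sqrt (1 / 2 - 1 / (4 * sqrt 6)
                                     * sqrt ((sqrt (48 * x + 1) - 1) / x)))) ^ 2
       / RtoC (root4 (24 * x + sqrt (48 * x + 1) + 1)))%C
    0 1
    (RtoC (PI ^ 2 * (143 - 20 * PI / sqrt 3) / (480 * root4 2))).
Proof.
assert (Hpi := PI_RGT_0).
assert (R2 := sqrt_lt_R0 2 ltac:(lra)); assert (S2 := sqrt_sqrt 2 ltac:(lra)).
assert (R3 := sqrt_lt_R0 3 ltac:(lra)); assert (S3 := sqrt_sqrt 3 ltac:(lra)).
assert (R6 := sqrt_lt_R0 6 ltac:(lra)); assert (S6 := sqrt_sqrt 6 ltac:(lra)).
assert (Hr := root4_pos 2); assert (Hr2 := root4_2).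
assert (Hr4 : root4 2 ^ 4 = 2) by (transitivity ((root4 2 ^ 2) ^ 2); [ring | rewrite Hr2; lra]).
split; [|split; [|split]].
- (* c = 1 and d = 1: here u = sqrt (1 - x) already appears in the integrand *)
  replace (PI ^ 2 * (17 / 30 - ln (1 + sqrt 2) / (2 * sqrt 2)))
    with (moment_value 1 (2 * ln (1 + sqrt 2)) / (sqrt 2 * root4 1)).
  + apply (is_RInt_elliptic 1 1); [apply is_RInt_weighted_K2_1 | lra | |]; intros x Hx.
    * transitivity (Csqrt (RtoC (1 / 2 - 1 / sqrt 2 * sqrt ((1 - sqrt (1 - x)) / x)))
        * Csqrt (RtoC (1 / 2 - 1 / sqrt 2 * sqrt ((1 - sqrt (1 - x)) / x))))%C; [ring|].
      rewrite Csqrt_sqr; f_equal.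
      assert (Hu := sqrt_pos (1 - x)); assert (Su := sqrt_sqrt (1 - x) ltac:(lra)).
      rewrite Rmult_1_l, (sqrt_eq_kernel_mean ((1 - sqrt (1 - x)) / x) (/ sqrt 2) x); [| apply Rlt_le, Rinv_0_lt_compat, R2 |].
      -- transitivity (1 / 2 - kernel_mean x / (sqrt 2 * sqrt 2)); [field; lra | rewrite S2; field].
      -- set (u := sqrt (1 - x)) in *; replace x with (1 - u * u) by lra.
         assert (1 - u <> 0) by nra.
         transitivity (2 / (1 + u) / (sqrt 2 * sqrt 2)); [rewrite S2; field | field]; repeat split; nra.
    * rewrite !Rmult_1_l; assert (Su := sqrt_sqrt (1 - x) ltac:(lra)); nra.
  + unfold moment_value; rewrite kernel_mean_1; unfold root4 at 1.
    replace (Rpower 1 (1 / 4)) with 1 by (unfold Rpower; rewrite ln_1, Rmult_0_r, exp_0; reflexivity).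
    replace (sqrt 2 ^ 3) with (sqrt 2 * sqrt 2 * sqrt 2) by ring.
    replace (sqrt 2 ^ 5) with (sqrt 2 * sqrt 2 * (sqrt 2 * sqrt 2) * sqrt 2) by ring.
    rewrite S2; field; lra.
- (* c = -16/9 and d = 9/2: sqrt (16 x + 9) = 3 u, and u = 5/3 at x = 1 *)
  replace (1 / root4 2 * (47 * PI ^ 2 / 160 - PI ^ 3 / (16 * sqrt 3)))
    with (moment_value (- (4 / 3) ^ 2) (2 / (4 / 3) * atan (4 / 3 * kernel_mean (- (4 / 3) ^ 2) / 2)) / (sqrt 2 * root4 (9 / 2))).
  + apply (is_RInt_elliptic (- (4 / 3) ^ 2) (9 / 2)); [apply is_RInt_weighted_K2_neg; lra | lra | |]; intros x Hx;
      assert (Eu : sqrt (16 * x + 9) = 3 * sqrt (1 - - (4 / 3) ^ 2 * x))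
        by (replace (16 * x + 9) with (3 ^ 2 * (1 - - (4 / 3) ^ 2 * x)) by field;
            rewrite sqrt_mult_alt, sqrt_pow2 by lra; reflexivity);
      assert (Hu := sqrt_lt_R0 (1 - - (4 / 3) ^ 2 * x) ltac:(nra));
      assert (Su := sqrt_sqrt (1 - - (4 / 3) ^ 2 * x) ltac:(nra));
      assert (Ha1 := kernel_mean_neg_le1 (- (4 / 3) ^ 2 * x) ltac:(nra)); rewrite Eu.
    * rewrite (sqrt_eq_kernel_mean ((3 * sqrt (1 - - (4 / 3) ^ 2 * x) - 3) / x) (4 / sqrt 6) (- (4 / 3) ^ 2 * x)); [| apply Rlt_le, Rdiv_lt_0_compat; lra |].
      -- rewrite RtoC_mult, Cpow_mult_l, RtoC_sqrt_sqr, <- RtoC_pow, <- RtoC_mult; [f_equal|].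
         ++ transitivity ((4 - 4 * kernel_mean (- (4 / 3) ^ 2 * x)) / (4 * (sqrt 2 * sqrt 2))); [field; lra | rewrite S2; field].
         ++ replace (sqrt 6 * (4 / sqrt 6 * kernel_mean (- (4 / 3) ^ 2 * x))) with (4 * kernel_mean (- (4 / 3) ^ 2 * x)) by (field; lra); lra.
      -- set (u := sqrt (1 - - (4 / 3) ^ 2 * x)) in *.
         assert (Ex : x = 9 / 16 * (u * u - 1)) by lra.
         assert (u - 1 <> 0) by nra.
         rewrite Ex; transitivity (16 / (sqrt 6 * sqrt 6) * (2 / (1 + u))); [rewrite S6; field | field]; repeat split; nra.
    * nra.
  + assert (E9 : root4 (9 / 2) = sqrt 3 / root4 2).
    { replace (9 / 2) with (1 / 2 * 3 ^ 2) by field; rewrite root4_mult_sqr, root4_half by lra; field; lra. }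
    assert (Ea : kernel_mean (- (4 / 3) ^ 2) = sqrt 3 / 2).
    { unfold kernel_mean; replace (1 - - (4 / 3) ^ 2) with ((5 / 3) ^ 2) by field; rewrite sqrt_pow2 by lra.
      replace (2 / (1 + 5 / 3)) with (3 / 2 ^ 2) by field; rewrite sqrt_div_alt, sqrt_pow2 by lra; reflexivity. }
    unfold moment_value; rewrite E9, Ea.
    rewrite (atan_eq _ (PI / 6)); [| lra |].
    2: { rewrite tan_PI6; transitivity (sqrt 3 / (sqrt 3 * sqrt 3)); [field; lra | rewrite S3; field]. }
    replace ((sqrt 3 / 2) ^ 3) with ((sqrt 3 * sqrt 3) * sqrt 3 / 8) by field.
    replace ((sqrt 3 / 2) ^ 5) with ((sqrt 3 * sqrt 3) * (sqrt 3 * sqrt 3) * sqrt 3 / 32) by field.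
    rewrite S3, <- Hr2; field; lra.
- (* c = -8 and d = 1/2: u = 3 at x = 1 *)
  replace (1 / Rpower 2 (7 / 4) * (71 * PI ^ 2 / 60 - PI ^ 3 / 8))
    with (moment_value (- (2 * sqrt 2) ^ 2) (2 / (2 * sqrt 2) * atan (2 * sqrt 2 * kernel_mean (- (2 * sqrt 2) ^ 2) / 2)) / (sqrt 2 * root4 (1 / 2))).
  + apply (is_RInt_elliptic (- (2 * sqrt 2) ^ 2) (1 / 2)); [apply is_RInt_weighted_K2_neg; lra | lra | |]; intros x Hx;
      replace (- (2 * sqrt 2) ^ 2) with (- 8) by (transitivity (- (4 * (sqrt 2 * sqrt 2))); [rewrite S2 | ]; ring);
      replace (8 * x + 1) with (1 - - 8 * x) by ring;
      assert (Hu := sqrt_lt_R0 (1 - - 8 * x) ltac:(nra));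
      assert (Su := sqrt_sqrt (1 - - 8 * x) ltac:(nra));
      assert (Ha1 := kernel_mean_neg_le1 (- 8 * x) ltac:(nra)).
    * rewrite (sqrt_eq_kernel_mean ((sqrt (1 - - 8 * x) - 1) / x) 2 (- 8 * x)); [| lra |].
      -- rewrite RtoC_sqrt_sqr by lra; f_equal; field.
      -- set (u := sqrt (1 - - 8 * x)) in *.
         assert (Ex : x = / 8 * (u * u - 1)) by lra.
         assert (u - 1 <> 0) by nra.
         rewrite Ex; field; repeat split; nra.
    * nra.
  + assert (E8 : - (2 * sqrt 2) ^ 2 = - 8) by (transitivity (- (4 * (sqrt 2 * sqrt 2))); [ring | rewrite S2; ring]).
    assert (Ea : kernel_mean (- 8) = / sqrt 2).
    { unfold kernel_mean; replace (1 - - 8) with (3 ^ 2) by ring; rewrite sqrt_pow2 by lra.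
      replace (2 / (1 + 3)) with (/ 2) by field; apply sqrt_inv. }
    assert (E7 : Rpower 2 (7 / 4) = root4 2 ^ 7).
    { unfold root4; rewrite <- Rpower_pow by apply exp_pos; rewrite Rpower_mult; f_equal; simpl; field. }
    unfold moment_value; rewrite E7, E8, root4_half, Ea.
    replace (2 * sqrt 2 * / sqrt 2 / 2) with 1 by (field; lra).
    rewrite atan_1, <- Hr2.
    replace (root4 2 ^ 7) with (root4 2 ^ 4 * root4 2 ^ 3) by ring; rewrite Hr4.
    replace ((/ root4 2 ^ 2) ^ 3) with (/ root4 2 ^ 4 * / root4 2 ^ 2) by (field; lra).
    replace ((/ root4 2 ^ 2) ^ 5) with (/ root4 2 ^ 4 * / root4 2 ^ 4 * / root4 2 ^ 2) by (field; lra).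
    rewrite Hr4; field; lra.
- (* c = -48 and d = 1/2: u = 7 at x = 1 *)
  replace (PI ^ 2 * (143 - 20 * PI / sqrt 3) / (480 * root4 2))
    with (moment_value (- (4 * sqrt 3) ^ 2) (2 / (4 * sqrt 3) * atan (4 * sqrt 3 * kernel_mean (- (4 * sqrt 3) ^ 2) / 2)) / (sqrt 2 * root4 (1 / 2))).
  + apply (is_RInt_elliptic (- (4 * sqrt 3) ^ 2) (1 / 2)); [apply is_RInt_weighted_K2_neg; lra | lra | |]; intros x Hx;
      replace (- (4 * sqrt 3) ^ 2) with (- 48) by (transitivity (- (16 * (sqrt 3 * sqrt 3))); [rewrite S3 | ]; ring);
      replace (48 * x + 1) with (1 - - 48 * x) by ring;
      assert (Hu := sqrt_lt_R0 (1 - - 48 * x) ltac:(nra));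
      assert (Su := sqrt_sqrt (1 - - 48 * x) ltac:(nra));
      assert (Ha1 := kernel_mean_neg_le1 (- 48 * x) ltac:(nra)).
    * rewrite (sqrt_eq_kernel_mean ((sqrt (1 - - 48 * x) - 1) / x) (2 * sqrt 6) (- 48 * x)); [| lra |].
      -- replace (1 / 2 - 1 / (4 * sqrt 6) * (2 * sqrt 6 * kernel_mean (- 48 * x))) with ((1 - kernel_mean (- 48 * x)) / 2)
           by (field; lra).
         apply RtoC_sqrt_sqr; lra.
      -- set (u := sqrt (1 - - 48 * x)) in *.
         assert (Ex : x = / 48 * (u * u - 1)) by lra.
         assert (u - 1 <> 0) by nra.
         rewrite Ex; transitivity (4 * (sqrt 6 * sqrt 6) * (2 / (1 + u))); [rewrite S6; field | field]; repeat split; nra.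
    * nra.
  + assert (E48 : - (4 * sqrt 3) ^ 2 = - 48) by (transitivity (- (16 * (sqrt 3 * sqrt 3))); [ring | rewrite S3; ring]).
    assert (Ea : kernel_mean (- 48) = / 2).
    { unfold kernel_mean; replace (1 - - 48) with (7 ^ 2) by ring; rewrite sqrt_pow2 by lra.
      replace (2 / (1 + 7)) with ((/ 2) ^ 2) by field; apply sqrt_pow2; lra. }
    unfold moment_value; rewrite E48, root4_half, Ea.
    rewrite (atan_eq _ (PI / 3)); [| lra | rewrite tan_PI3; field].
    rewrite <- Hr2; field; lra.
Qed.
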